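(* Let $M$ be a smooth manifold of dimension $2m$ and let $\varphi$ be a generalized Calabi-Yau structure on $M$. Then the annihilator $E_\varphi\subset (T\oplus T^* )\otimes\mathbf{C}$ of $\varphi$ defines a generalized complex structure on $M$.
   Context: $T$ is the tangent bundle of $M$. The bundle $T\oplus T^*$ carries the indefinite metric determined by the quadratic form $(v+\xi,v+\xi)=-\langle v,\xi\rangle$, extended complex-bilinearly to $(T\oplus T^* )\otimes\mathbf{C}$. It acts on (mixed degree, complex) forms by $(v+\xi)\cdot\varphi=\iota(v)\varphi+\xi\wedge\varphi$, extended complex-linearly. The annihilator of $\varphi$ at a point is $E_\varphi=\{v+\xi\in (T\oplus T^* )\otimes\mathbf{C} : (v+\xi)\cdot\varphi=0\}$; it is isotropic, and $\varphi$ is called a complex pure spinor if at every point $E_\varphi$ is maximally isotropic, i.e. of complex dimension $\dim M=2m$. With $n=2m$, the bilinear form on even (resp. odd) forms, with values in top-degree forms, is $\langle\varphi,\psi\rangle=\sum_k(-1)^k\varphi_{2k}\wedge\psi_{n-2k}$ (resp. $\langle\varphi,\psi\rangle=\sum_k(-1)^k\varphi_{2k+1}\wedge\psi_{n-2k-1}$), where $\varphi_p$ is the degree $p$ component of $\varphi$. A generalized Calabi-Yau structure on $M$ is a closed complex form $\varphi$, either in $\Omega^{ev}\otimes\mathbf{C}$ (mixed even degree) or in $\Omega^{od}\otimes\mathbf{C}$ (mixed odd degree), which is a complex pure spinor and satisfies $\langle\varphi,\bar\varphi\rangle\neq0$ at each point. The Courant bracket on sections of $T\oplus T^*$ (extended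 complex-bilinearly) is $$[X+\xi,Y+\eta]=[X,Y]+\mathcal{L}_X\eta-\mathcal{L}_Y\xi-\tfrac12 d(\iota(X)\eta-\iota(Y)\xi).$$ A generalized complex structure on $M$ is a subbundle $E\subset(T\oplus T^* )\otimes\mathbf{C}$ such that $E\oplus\bar E=(T\oplus T^* )\otimes\mathbf{C}$, the space of sections of $E$ is closed under the Courant bracket, and $E$ is isotropic. *)

(* Defs.v *)
From HB Require Import structures.
From mathcomp Require Import all_boot all_order all_algebra all_fingroup.
From mathcomp Require Import all_classical all_reals all_analysis.
From mathcomp Require Import complex.

Set Implicit Arguments.
Unset Strict Implicit.
Unset Printing Implicit Defensive.

Import Order.TTheory GRing.Theory Num.Theory numFieldNormedType.Exports.

Local Open Scope classical_set_scope.
Local Open Scope ring_scope.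

Section Smooth.
Context {R : realType} {n : nat}.

Definition partial (j : 'I_n) (f : 'rV[R]_n -> R) (x : 'rV[R]_n) : R :=
  'D_(delta_mx 0 j) f x.

(* For open [U]: f is C^oo on U iff all its iterated partial derivatives are
   (Frechet) differentiable on U. *)
Definition smooth_on (U : set 'rV[R]_n) (f : 'rV[R]_n -> R) : Prop :=
  forall (s : seq 'I_n) x, U x -> differentiable (foldr partial f s) x.

Definition csmooth_on (U : set 'rV[R]_n) (f : 'rV[R]_n -> R[i]) : Prop :=
  smooth_on U (fun x => complex.Re (f x)) /\
  smooth_on U (fun x => complex.Im (f x)).

Definition cpartial (j : 'I_n) (f : 'rV[R]_n -> R[i]) (x : 'rV[R]_n) : R[i] :=
  (partial j (fun y => complex.Re (f y)) x +i*
   partial j (fun y => complex.Im (f y)) x)%C.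

(* Derivative along a complex tangent vector, complex-linear in [v]. *)
Definition cderive (v : 'rV[R[i]]_n) (f : 'rV[R]_n -> R[i]) (x : 'rV[R]_n)
    : R[i] :=
  \sum_(j < n) v 0 j * cpartial j f x.

End Smooth.

Section Manifold.
Context {R : realType}.

(* [chart_map] and [chart_inv] are total functions; only their values on
   [chart_dom] and on its image are meaningful. *)
Record chart (M : topologicalType) (n : nat) := Chart {
  chart_dom : set M;
  chart_map :> M -> 'rV[R]_n;
  chart_inv : 'rV[R]_n -> M;
  chart_dom_open : open chart_dom;
  chart_img_open : open (chart_map @` chart_dom);
  chart_mapK : forall p, chart_dom p -> chart_inv (chart_map p) = p;
  chart_map_cont : forall p, chart_dom p -> {for p, continuous chart_map};
  chart_inv_cont :
    forall p, chart_dom p -> {for chart_map p, continuous chart_inv} }.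

Definition transition (M : topologicalType) n (c c' : chart M n)
    : 'rV[R]_n -> 'rV[R]_n := c' \o chart_inv c.

Record manifold (n : nat) := Manifold {
  space :> topologicalType;
  manifold_hausdorff : hausdorff_space space;
  manifold_second_countable : @second_countable space;
  atlas : set (chart space n);
  atlas_cover : forall p, exists2 c, atlas c & chart_dom c p;
  atlas_smooth : forall c c', atlas c -> atlas c' -> forall j,
    smooth_on (c @` (chart_dom c `&` chart_dom c'))
              (fun x => transition c c' x 0 j) }.

End Manifold.
Arguments chart : clear implicits.
Arguments manifold : clear implicits.

Section LinearAlgebra.
Context {R : realType} {n : nat}.

(* Elements v + xi of (V (+) V^* ) (x) C for V = R^n; a covector is the row of
   its components. *)
Definition gvec : Type := ('rV[R[i]]_n * 'rV[R[i]]_n)%type.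

Definition contract (v xi : 'rV[R[i]]_n) : R[i] := \sum_(j < n) xi 0 j * v 0 j.

(* Polarization of the quadratic form (v + xi, v + xi) = - <v, xi>. *)
Definition gmetric (u w : gvec) : R[i] :=
  - 2^-1 * (contract u.1 w.2 + contract w.1 u.2).

Definition conjg (u : gvec) : gvec := (map_mx conjc u.1, map_mx conjc u.2).

(* A complex form of mixed degree on V is a single function on lists of complex
   vectors; its component of degree k is its restriction to lists of size k. *)
Definition mixed_form : Type := seq 'rV[R[i]]_n -> R[i].

Definition is_form (phi : mixed_form) : Prop :=
  (forall s1 s2 (a : R[i]) u v,
     phi (s1 ++ (a *: u + v) :: s2) =
     a * phi (s1 ++ u :: s2) + phi (s1 ++ v :: s2)) /\
  (forall s1 s2 s3 u, phi (s1 ++ u :: s2 ++ u :: s3) = 0).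

Definition component (k : nat) (phi : mixed_form) : mixed_form :=
  fun s => if size s == k then phi s else 0.

Definition even_form (phi : mixed_form) : Prop :=
  forall s, odd (size s) -> phi s = 0.
Definition odd_form (phi : mixed_form) : Prop :=
  forall s, ~~ odd (size s) -> phi s = 0.

(* The normalization making (alpha /\ beta)(u, v) equal to
   alpha u * beta v - alpha v * beta u for one-forms. *)
Definition wedge (phi psi : mixed_form) : mixed_form := fun s =>
  \sum_(p < (size s).+1)
    ((p`! * (size s - p)`!)%N%:R)^-1 *
    \sum_(sigma : 'S_(size s))
      let t := [seq nth 0 s (sigma i) | i : 'I_(size s)] in
      (-1) ^+ sigma * phi (take p t) * psi (drop p t).

Definition interior_product (v : 'rV[R[i]]_n) (phi : mixed_form) : mixed_form :=
  fun s => phi (v :: s).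

Definition covector_form (xi : 'rV[R[i]]_n) : mixed_form :=
  fun s => if s is [:: v] then contract v xi else 0.

Definition clifford (u : gvec) (phi : mixed_form) : mixed_form :=
  fun s => interior_product u.1 phi s + wedge (covector_form u.2) phi s.

Definition conj_form (phi : mixed_form) : mixed_form :=
  fun s => conjc (phi [seq map_mx conjc v | v <- s]).

Definition pairing_even (phi psi : mixed_form) : mixed_form := fun s =>
  \sum_(k < n.+1 | (k.*2 <= n)%N)
    (-1) ^+ k * wedge (component k.*2 phi) (component (n - k.*2) psi) s.

Definition pairing_odd (phi psi : mixed_form) : mixed_form := fun s =>
  \sum_(k < n.+1 | (k.*2.+1 <= n)%N)
    (-1) ^+ k * wedge (component k.*2.+1 phi) (component (n - k.*2.+1) psi) s.

Definition delete_nth (i : nat) (s : seq 'rV[R[i]]_n) := take i s ++ drop i.+1 s.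

(* d phi (v_0, ..., v_k) = \sum_i (-1)^i d_{v_i} (phi (.. v_i omitted ..)) for
   constant vectors. *)
Definition dform (phi : 'rV[R]_n -> mixed_form) (x : 'rV[R]_n)
    : mixed_form := fun s =>
  \sum_(i < size s)
    (-1) ^+ i * cderive (nth 0 s i) (fun y => phi y (delete_nth i s)) x.

Definition lie_bracket (X Y : 'rV[R]_n -> 'rV[R[i]]_n) (x : 'rV[R]_n)
    : 'rV[R[i]]_n :=
  \row_j (cderive (X x) (fun y => Y y 0 j) x - cderive (Y x) (fun y => X y 0 j) x).

Definition lie_derive (X eta : 'rV[R]_n -> 'rV[R[i]]_n) (x : 'rV[R]_n)
    : 'rV[R[i]]_n :=
  \row_j (cderive (X x) (fun y => eta y 0 j) x +
          \sum_(k < n) eta x 0 k * cpartial j (fun y => X y 0 k) x).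

Definition differential (f : 'rV[R]_n -> R[i]) (x : 'rV[R]_n) : 'rV[R[i]]_n :=
  \row_j cpartial j f x.

Definition courant_coord (s t : 'rV[R]_n -> gvec) (x : 'rV[R]_n) : gvec :=
  let X := fun y => (s y).1 in let xi := fun y => (s y).2 in
  let Y := fun y => (t y).1 in let eta := fun y => (t y).2 in
  (lie_bracket X Y x,
   lie_derive X eta x - lie_derive Y xi x -
   2^-1 *: differential
     (fun y => contract (X y) (eta y) - contract (Y y) (xi y)) x).

End LinearAlgebra.
Arguments gvec : clear implicits.
Arguments mixed_form : clear implicits.

Section Fields.
Context {R : realType} {n : nat} (M : manifold R n).

Definition chart_at (p : M) : chart R M n := s2val (cid2 (atlas_cover p)).

(* The fibre at p of T (x) C (resp. T^* (x) C, resp. complex forms) is C^n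
   (resp. C^n, resp. forms on C^n), by means of the chart [chart_at p]; thus a
   section of (T (+) T^* ) (x) C is a map [M -> gvec R n].  The components of a
   vector, covector or form in another chart around p are given by the usual
   transformation rules under change of coordinates. *)
Definition cjacobian (c c' : chart R M n) (p : M) : 'M[R[i]]_n :=
  map_mx (real_complex R) ('J (transition c c') (c p)).

Definition gvec_in (c : chart R M n) (p : M) (u : gvec R n) : gvec R n :=
  (u.1 *m cjacobian (chart_at p) c p, u.2 *m (cjacobian c (chart_at p) p)^T).

Definition form_in (c : chart R M n) (p : M) (phi : mixed_form R n)
    : mixed_form R n :=
  fun s => phi [seq v *m cjacobian c (chart_at p) p | v <- s].

Definition gsection_in (c : chart R M n) (s : M -> gvec R n) (x : 'rV[R]_n)
    : gvec R n :=
  gvec_in c (chart_inv c x) (s (chart_inv c x)).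

Definition form_field_in (c : chart R M n) (phi : M -> mixed_form R n)
    (x : 'rV[R]_n) : mixed_form R n :=
  form_in c (chart_inv c x) (phi (chart_inv c x)).

Definition smooth_gsection (U : set M) (s : M -> gvec R n) : Prop :=
  forall c, atlas c -> forall j,
    csmooth_on (c @` (chart_dom c `&` U)) (fun x => (gsection_in c s x).1 0 j) /\
    csmooth_on (c @` (chart_dom c `&` U)) (fun x => (gsection_in c s x).2 0 j).

Definition differential_form (phi : M -> mixed_form R n) : Prop :=
  (forall p, is_form (phi p)) /\
  (forall c, atlas c -> forall s,
     csmooth_on (c @` chart_dom c) (fun x => form_field_in c phi x s)).

(* Exterior derivative and Courant bracket are computed at p in the chart
   [chart_at p], in which the fibre at p is written. *)
Definition exterior_derivative (phi : M -> mixed_form R n) (p : M)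
    : mixed_form R n :=
  dform (form_field_in (chart_at p) phi) (chart_at p p).

Definition courant (s t : M -> gvec R n) (p : M) : gvec R n :=
  courant_coord (gsection_in (chart_at p) s) (gsection_in (chart_at p) t)
    (chart_at p p).

Definition annihilator (phi : M -> mixed_form R n) (p : M) : set (gvec R n) :=
  [set u | clifford u (phi p) = cst 0].

(* Isotropic subspaces have dimension at most n, so for the annihilator, which
   is isotropic, dimension n is maximality. *)
Definition pure_spinor (phi : M -> mixed_form R n) : Prop :=
  forall p, exists2 U : {vspace gvec R n},
    annihilator phi p = [set` U] & \dim U = n.

Definition generalized_calabi_yau (phi : M -> mixed_form R n) : Prop :=
  [/\ differential_form phi,
      forall p, exterior_derivative phi p = cst 0,
      pure_spinor phi &
      ((forall p, even_form (phi p)) /\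
       (forall p, pairing_even (phi p) (conj_form (phi p)) <> cst 0)) \/
      ((forall p, odd_form (phi p)) /\
       (forall p, pairing_odd (phi p) (conj_form (phi p)) <> cst 0))].

Definition subbundle (E : M -> set (gvec R n)) : Prop :=
  forall p, exists (r : nat) (U : set M) (e : 'I_r -> M -> gvec R n),
    [/\ open U, U p, forall i, smooth_gsection U (e i) &
        forall q, U q ->
          free [seq e i q | i : 'I_r] /\
          E q = [set` <<[seq e i q | i : 'I_r]>>%VS]].

Definition section_of (E : M -> set (gvec R n)) (s : M -> gvec R n) : Prop :=
  smooth_gsection setT s /\ forall p, E p (s p).

Definition generalized_complex_structure (E : M -> set (gvec R n)) : Prop :=
  [/\ subbundle E,
      forall p,
        (forall w, exists u v, [/\ E p u, E p v & w = u + conjg v]) /\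
        (forall u v, E p u -> E p v -> u = conjg v -> u = 0),
      forall s t, section_of E s -> section_of E t -> section_of E (courant s t) &
      forall p u w, E p u -> E p w -> gmetric u w = 0].

End Fields.

(* Main.v *)
From Pilot Require Import Defs.
From HB Require Import structures.
From mathcomp Require Import all_boot all_order all_algebra all_fingroup.
From mathcomp Require Import all_classical all_reals all_analysis.
From mathcomp Require Import complex ring lra zify.
Import Pilot.Defs.

(**
  The annihilator of a generalized Calabi-Yau form is studied through the
  Clifford action u . phi = i_v phi + xi /\ phi of u = v + xi, whose only
  relation is u . (w . phi) + w . (u . phi) = <u, w> phi, where
  <u, w> = eta(v) + xi(x) for w = x + eta ([cl_anticommute]).

  Isotropy is immediate from this relation, since phi does not vanish: otherwise
  its pairing with its conjugate would.

  E and its conjugate meet trivially because a common annihilator u <> 0 of two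
  forms phi and psi makes their pairing zero ([common_annihilator_pairing]).
  Up to signs depending on the degree, the pairing is the top degree part of a
  wedge product Om of phi and psi.  If u = v + xi with v <> 0, the signs are such
  that the terms of i_v Om cancel; choosing a covector eta with eta(v) = 1, one
  gets Om = i_v (eta /\ Om), and eta /\ Om vanishes in degree n + 1.  If v = 0,
  both phi and psi are multiples of xi, hence Om = 0.  As E has dimension n in a
  space of dimension 2n, the sum of E and its conjugate is everything.

  E is a smooth subbundle: near a point it is the kernel of finitely many linear
  forms depending smoothly on the point.  Combining these and completing them by
  constant ones gives a smooth invertible matrix M, and the last n rows of its
  inverse are a frame of the kernel ([local_frame]).

  For the Courant bracket, let s = X + xi and t = Y + eta be sections of E.
  Since <s, t> = 0 the bracket is X^j d_j t - Y^j d_j s - <s, d_j t> dx^j.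
  Differentiating s . phi = t . phi = 0 and using
  d phi = sum_j dx^j /\ d_j phi = 0 together with the Clifford relation shows that
  this vector kills phi ([courant_annihilates]).  That the bracket of smooth
  sections is smooth requires more: the bracket at p is computed in a chart that
  depends on p, so smoothness rests on the invariance of the bracket under
  changes of coordinates ([related_courant]), which in turn rests on the symmetry
  of the second derivatives of the transition maps ([derive_swap]).
*)

Set Implicit Arguments.
Unset Strict Implicit.
Unset Printing Implicit Defensive.

Import Order.TTheory GRing.Theory Num.Theory numFieldNormedType.Exports.

Local Open Scope classical_set_scope.
Local Open Scope ring_scope.

(** * Alternating forms *)

Section ExteriorAlgebra.
Context {R : realType} {n : nat}.
Local Notation C := R[i].
Local Notation V := 'rV[C]_n.
Local Notation form := (mixed_form R n).
Local Notation iota := interior_product.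

Implicit Types (phi psi : form) (s : seq V) (u v : V) (xi eta : V).

Definition grading phi : form := fun s => (-1) ^+ size s * phi s.

(** The wedge product in terms of the rule
    i_v (phi /\ psi) = i_v phi /\ psi + eps phi /\ i_v psi, where eps is the
    sign by degree; identities between products then follow by induction on the
    list of arguments, without permutations. *)
Fixpoint shuffle s phi psi : C :=
  if s is v :: s' then
    shuffle s' (iota v phi) psi + shuffle s' (grading phi) (iota v psi)
  else phi [::] * psi [::].

Definition swedge phi psi : form := fun s => shuffle s phi psi.
#[global] Arguments swedge : simpl never.

(** Exterior multiplication by a covector, in terms of the rule
    i_v (xi /\ phi) = xi(v) phi - xi /\ i_v phi. *)
Fixpoint ext_rec xi s phi : C :=
  if s is v :: s' then contract v xi * phi s' - ext_rec xi s' (iota v phi)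
  else 0.

Definition ext xi phi : form := fun s => ext_rec xi s phi.
#[global] Arguments ext : simpl never.

Definition lincomb (a : C) phi psi : form := fun s => a * phi s + psi s.

Lemma is_form_interior v phi : is_form phi -> is_form (iota v phi).
Proof.
move=> [lin alt]; split=> [s1 s2 a u w|s1 s2 s3 u].
  exact: (lin (v :: s1)).
exact: (alt (v :: s1)).
Qed.

Lemma is_form_grading phi : is_form phi -> is_form (grading phi).
Proof.
move=> [lin alt]; split=> [s1 s2 a u w|s1 s2 s3 u]; rewrite /grading.
  rewrite lin !size_cat /=; ring.
by rewrite alt mulr0.
Qed.

Lemma is_form_lincomb a phi psi :
  is_form phi -> is_form psi -> is_form (lincomb a phi psi).
Proof.
move=> [lin alt] [lin' alt']; split=> [s1 s2 b u w|s1 s2 s3 u]; rewrite /lincomb.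
  rewrite lin lin'; ring.
by rewrite alt alt' mulr0 addr0.
Qed.

Lemma formD1 phi s1 s2 u v : is_form phi ->
  phi (s1 ++ (u + v) :: s2) = phi (s1 ++ u :: s2) + phi (s1 ++ v :: s2).
Proof. by case=> lin _; rewrite -[u]scale1r lin mul1r scale1r. Qed.

Lemma form0 phi s1 s2 : is_form phi -> phi (s1 ++ 0 :: s2) = 0.
Proof.
move=> fphi; have := @formD1 phi s1 s2 0 0 fphi; rewrite addr0 => /eqP.
by rewrite -subr_eq0 opprD addrA subrr sub0r oppr_eq0 => /eqP.
Qed.

Lemma formZ phi s1 s2 a u : is_form phi ->
  phi (s1 ++ (a *: u) :: s2) = a * phi (s1 ++ u :: s2).
Proof.
by move=> fphi; have := fphi.1 s1 s2 a u 0; rewrite addr0 form0// addr0.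
Qed.

Lemma form_sum phi s1 s2 (I : Type) (r : seq I) (P : pred I) (F : I -> V) :
  is_form phi ->
  phi (s1 ++ (\sum_(i <- r | P i) F i) :: s2) =
  \sum_(i <- r | P i) phi (s1 ++ F i :: s2).
Proof.
move=> fphi; elim: r => [|i r IH]; first by rewrite !big_nil form0.
by rewrite !big_cons; case: (P i); rewrite // formD1// IH.
Qed.

Lemma skew_of_alternating (f : V -> V -> C) :
  (forall u v w, f (u + v) w = f u w + f v w) ->
  (forall u v w, f w (u + v) = f w u + f w v) ->
  (forall u, f u u = 0) -> forall u v, f u v = - f v u.
Proof.
move=> Dl Dr alt u v; apply/eqP; rewrite -subr_eq0 opprK.
by have := alt (u + v); rewrite Dl !Dr !alt add0r addr0 => ->.
Qed.

(** Alternation in adjacent places suffices: adjacent transpositions generate the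
    symmetric group. *)
Lemma is_form_adjacent phi :
  (forall s1 s2 (a : C) u v,
     phi (s1 ++ (a *: u + v) :: s2) =
     a * phi (s1 ++ u :: s2) + phi (s1 ++ v :: s2)) ->
  (forall s1 s2 u, phi (s1 ++ [:: u, u & s2]) = 0) ->
  is_form phi.
Proof.
move=> lin alt; split=> // s1 s2 s3 u.
have skew t1 t2 v w : phi (t1 ++ [:: v, w & t2]) = - phi (t1 ++ [:: w, v & t2]).
  have D r1 r2 x y :
      phi (r1 ++ (x + y) :: r2) = phi (r1 ++ x :: r2) + phi (r1 ++ y :: r2).
    by rewrite -[x]scale1r lin mul1r scale1r.
  apply: (@skew_of_alternating (fun v w => phi (t1 ++ [:: v, w & t2]))) => //.
  move=> x y z; have := D (rcons t1 z) t2 x y.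
  by rewrite -!cats1 -!catA.
elim: s2 s1 => [|v s2 IH] s1; first exact: alt.
rewrite /= skew; have := IH (rcons s1 v).
by rewrite -cats1 -!catA /= => ->; rewrite oppr0.
Qed.

Lemma form_move_front phi v s1 s2 : is_form phi ->
  phi (s1 ++ v :: s2) = (-1) ^+ size s1 * phi (v :: s1 ++ s2).
Proof.
move=> fphi; elim: s1 phi fphi => [|w s1 IH] phi fphi; first by rewrite mul1r.
rewrite /= [LHS](IH (iota w phi)); last exact: is_form_interior.
rewrite /iota exprS mulN1r mulNr -mulrN; congr (_ * _).
apply: (@skew_of_alternating (fun v w => phi [:: v, w & s1 ++ s2])).
- by move=> x y z; exact: (@formD1 phi [::]).
- by move=> x y z; exact: (@formD1 phi [:: z]).
- by move=> x; exact: (fphi.2 [::] [::]).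
Qed.

Lemma interior_skew u v phi : is_form phi ->
  forall s, phi [:: u, v & s] = - phi [:: v, u & s].
Proof. by move=> fphi s; rewrite (@form_move_front phi v [:: u])//= mulN1r. Qed.

(** * Wedge product as a shuffle recursion *)

Lemma grading_interior v phi :
  iota v (grading phi) = lincomb (-1) (grading (iota v phi)) (fun=> 0).
Proof.
by apply/funext=> s; rewrite /lincomb /grading /iota /= exprS addr0 mulrA.
Qed.

Lemma gradingK phi : grading (grading phi) = phi.
Proof.
by apply/funext => s; rewrite /grading mulrA -exprD addnn -mul2n exprM sqrrN
  expr1n expr1n mul1r.
Qed.

Lemma swedge_lincombl a phi phi' psi :
  swedge (lincomb a phi phi') psi = lincomb a (swedge phi psi) (swedge phi' psi).
Proof.
apply/funext=> s; rewrite /swedge /lincomb.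
elim: s phi phi' psi => [|v s IH] phi phi' psi /=; first by ring.
have -> : iota v (fun s => a * phi s + phi' s) =
  fun s => a * iota v phi s + iota v phi' s by [].
have -> : grading (fun s => a * phi s + phi' s) =
  fun s => a * grading phi s + grading phi' s.
  by apply/funext=> t; rewrite /grading; ring.
rewrite !IH; ring.
Qed.

Lemma swedge_lincombr a phi psi psi' :
  swedge phi (lincomb a psi psi') = lincomb a (swedge phi psi) (swedge phi psi').
Proof.
apply/funext=> s; rewrite /swedge /lincomb.
elim: s phi psi psi' => [|v s IH] phi psi psi' /=; first by ring.
have -> : iota v (fun s => a * psi s + psi' s) =
  fun s => a * iota v psi s + iota v psi' s by [].
rewrite !IH; ring.
Qed.

Lemma swedge0l psi : swedge (fun=> 0) psi = fun=> 0.
Proof.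
have := swedge_lincombl (-1) (fun=> 0) (fun=> 0) psi; rewrite /lincomb.
have -> : (fun _ : seq V => -1 * 0 + 0 : C) = fun=> 0.
  by apply/funext=> s; rewrite mulr0 addr0.
by move=> ->; apply/funext=> s; rewrite mulN1r addNr.
Qed.

Lemma swedge0r phi : swedge phi (fun=> 0) = fun=> 0.
Proof.
have := swedge_lincombr (-1) phi (fun=> 0) (fun=> 0); rewrite /lincomb.
have -> : (fun _ : seq V => -1 * 0 + 0 : C) = fun=> 0.
  by apply/funext=> s; rewrite mulr0 addr0.
by move=> ->; apply/funext=> s; rewrite mulN1r addNr.
Qed.

Lemma swedgeZl a phi psi s :
  swedge (fun s => a * phi s) psi s = a * swedge phi psi s.
Proof.
have := congr1 (@^~ s) (swedge_lincombl a phi (fun=> 0) psi).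
rewrite /lincomb swedge0l addr0 => <-; congr (swedge _ _ _).
by apply/funext=> t; rewrite addr0.
Qed.

Lemma swedgeZr a phi psi s :
  swedge phi (fun s => a * psi s) s = a * swedge phi psi s.
Proof.
have := congr1 (@^~ s) (swedge_lincombr a phi psi (fun=> 0)).
rewrite /lincomb swedge0r addr0 => <-; congr (swedge _ _ _).
by apply/funext=> t; rewrite addr0.
Qed.

Lemma swedge_cons phi psi v s : swedge phi psi (v :: s) =
  swedge (iota v phi) psi s + swedge (grading phi) (iota v psi) s.
Proof. by []. Qed.

Lemma iota_lin phi a u v : is_form phi ->
  iota (a *: u + v) phi = lincomb a (iota u phi) (iota v phi).
Proof. by case=> lin _; apply/funext=> s; exact: (lin [::]). Qed.

Lemma iota_iota phi u : is_form phi -> iota u (iota u phi) = fun=> 0.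
Proof. by case=> _ alt; apply/funext=> s; exact: (alt [::] [::]). Qed.

Lemma is_form_swedge phi psi :
  is_form phi -> is_form psi -> is_form (swedge phi psi).
Proof.
move=> fphi fpsi; apply: is_form_adjacent.
- move=> s1; elim: s1 phi psi fphi fpsi => [|w s1 IH] phi psi fphi fpsi s2 a u v.
    rewrite /= !swedge_cons !iota_lin// swedge_lincombl swedge_lincombr /lincomb.
    ring.
  rewrite /= !swedge_cons !IH; first ring;
    by try exact: is_form_interior; try exact: is_form_grading.
- move=> s1; elim: s1 phi psi fphi fpsi => [|w s1 IH] phi psi fphi fpsi s2 u.
    rewrite /= !swedge_cons grading_interior swedge_lincombl gradingK.
    rewrite !iota_iota// swedge0l swedge0l swedge0r /lincomb.
    by rewrite mulN1r add0r !addr0 subrr.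
  rewrite /= !swedge_cons !IH ?addr0//;
    by try exact: is_form_interior; try exact: is_form_grading.
Qed.

Lemma size_perm_seq s (f : 'S_(size s)) :
  size [seq nth 0 s (f i) | i : 'I_(size s)] = size s.
Proof. by rewrite size_map size_enum_ord. Qed.

Lemma nth_perm_seq s (f : 'S_(size s)) (i : 'I_(size s)) :
  nth 0 [seq nth 0 s (f i) | i : 'I_(size s)] i = nth 0 s (f i).
Proof. by rewrite (nth_map i) ?size_enum_ord// nth_ord_enum. Qed.

(** Permutations of v :: s are regrouped by the place j of v; the others are
    permutations of s with v inserted at that place. *)
Lemma perm_seq_lift v s (j : 'I_(size s).+1) (f : 'S_(size s)) :
  let t := [seq nth 0 s (f i) | i : 'I_(size s)] in
  [seq nth 0 (v :: s) (lift_perm j ord0 f i) | i : 'I_(size (v :: s))] =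
  take j t ++ v :: drop j t.
Proof.
set t := [seq _ | _ : _]; cbv zeta.
have st : size t = size s by rewrite size_perm_seq.
have jt : (j <= size t)%N by rewrite st -ltnS.
have szt : size (take j t) = j by rewrite size_take_min; apply/minn_idPl.
apply: (@eq_from_nth _ 0).
  by rewrite (@size_perm_seq (v :: s)) size_cat /= szt size_drop addnS subnKC// st.
move=> k; rewrite (@size_perm_seq (v :: s)) => klt.
rewrite -[k]/(nat_of_ord (Ordinal klt)) (@nth_perm_seq (v :: s)).
case: (unliftP j (Ordinal klt)) => [i|] ->; last first.
  by rewrite lift_perm_id nth_cat szt ltnn subnn.
rewrite lift_perm_lift nth_cat szt /= /bump /= add0n.
have [ji|ij] := leqP j i.
  rewrite add1n ltnNge (leq_trans ji) ?leqnSn//= subSn// /= nth_drop subnKC//.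
  by rewrite nth_perm_seq.
by rewrite add0n ij nth_take// nth_perm_seq.
Qed.

(** Injectivity suffices, as (N + 1) N! = (N + 1)!. *)
Lemma sum_lift_perm N (F : 'S_N.+1 -> C) :
  \sum_s F s = \sum_(j < N.+1) \sum_(f : 'S_N) F (lift_perm j ord0 f).
Proof.
rewrite pair_big /=.
have lb : bijective (fun p : 'I_N.+1 * 'S_N => lift_perm p.1 ord0 p.2).
  apply: inj_card_bij; last by rewrite card_prod card_ord !card_Sn factS.
  move=> [j f] [k g] /= e.
  have jk : j = k.
    apply/(@perm_inj _ (lift_perm k ord0 g)).
    by rewrite lift_perm_id -e lift_perm_id.
  subst k; congr (_, _); apply/permP=> i.
  by apply: (@lift_inj _ ord0); rewrite -(lift_perm_lift j) e lift_perm_lift.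
by rewrite (reindex _ (onW_bij _ lb)).
Qed.

Lemma sum_ltn_if N p (a b : C) : (p <= N)%N ->
  \sum_(j < N) (if (j < p)%N then a else b) = p%:R * a + (N - p)%N%:R * b.
Proof.
move=> pN; rewrite -(big_mkord xpredT (fun j => if (j < p)%N then a else b)).
rewrite (@big_cat_nat _ _ _ p)//=; congr (_ + _).
  rewrite (@eq_big_nat _ _ _ _ _ _ (fun=> a)).
    by rewrite sumr_const_nat subn0 mulr_natl.
  by move=> j /andP[_ ->].
rewrite (@eq_big_nat _ _ _ _ _ _ (fun=> b)).
  by rewrite sumr_const_nat mulr_natl.
by move=> j /andP[pj _]; rewrite ltnNge pj.
Qed.

(** Moving v to the front of the block that contains it costs a sign, which the
    sign (-1)^j of the insertion cancels up to the size of the first block. *)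
Lemma form_split_insert phi psi v (t : seq V) (j p : nat) :
  is_form phi -> is_form psi -> (j <= size t)%N ->
  let T := take j t ++ v :: drop j t in
  (-1) ^+ j * (phi (take p T) * psi (drop p T)) =
  if (j < p)%N then phi (v :: take p.-1 t) * psi (drop p.-1 t)
  else (-1) ^+ p * phi (take p t) * psi (v :: drop p t).
Proof.
move=> fphi fpsi jt T.
have szt : size (take j t) = j by rewrite size_take_min; apply/minn_idPl.
have sgn2 (k : nat) : (-1) ^+ k * (-1) ^+ k = 1 :> C.
  by rewrite -exprD addnn -mul2n exprM sqrrN !expr1n.
rewrite /T take_cat drop_cat szt; have [pj|jp] := ltnP p j.
  rewrite ltnNge (ltnW pj)/= take_takel ?(ltnW pj)//.
  have E : drop p (take j t) ++ drop j t = drop p t.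
    by rewrite -[in RHS](cat_take_drop j t) drop_cat szt pj.
  rewrite form_move_front// size_drop szt E.
  rewrite mulrCA mulrA -{1}(subnK (ltnW pj)) exprD.
  set e := (-1) ^+ (j - p) : C; have : e * e = 1 by exact: sgn2.
  set e' := (-1) ^+ p : C.
  by move=> ee; rewrite -[LHS]mulr1 -{1}ee; ring: ee.
case: (ltngtP j p) jp => // [jp _|jp _].
  rewrite -(subnSK jp) /= form_move_front// szt -takeD drop_drop.
  have -> : (j + (p - j.+1) = p.-1)%N by lia.
  have -> : (p - j.+1 + j = p.-1)%N by lia.
  by rewrite !mulrA sgn2 mul1r.
by rewrite jp subnn take0 drop0 cats0 mulrA.
Qed.

(** The p places of v in the first block contribute equally, and so do the
    N + 1 - p places in the second one; these multiplicities turn the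
    normalization p! (N + 1 - p)! into those of the products of degree N. *)
Lemma wedge_cons phi psi v s : is_form phi -> is_form psi ->
  wedge phi psi (v :: s) =
  wedge (iota v phi) psi s + wedge (grading phi) (iota v psi) s.
Proof.
move=> fphi fpsi; rewrite /wedge [size (v :: s)]/=; set N := size s.
pose t (f : 'S_N) := [seq nth 0 s (f i) | i : 'I_N].
have szt f : size (t f) = N by rewrite /t (@size_perm_seq s).
pose a p (f : 'S_N) := phi (v :: take p (t f)) * psi (drop p (t f)).
pose b p (f : 'S_N) := (-1) ^+ p * phi (take p (t f)) * psi (v :: drop p (t f)).
transitivity (\sum_(p < N.+2) ((p`! * (N.+1 - p)`!)%N%:R)^-1 *
   (p%:R * (\sum_(f : 'S_N) (-1) ^+ f * a p.-1 f) +
    (N.+1 - p)%N%:R * (\sum_(f : 'S_N) (-1) ^+ f * b p f)) : C).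
  apply: eq_bigr => p _; congr (_ * _); rewrite sum_lift_perm exchange_big /=.
  rewrite !mulr_sumr -big_split /=; apply: eq_bigr => f _.
  rewrite [RHS](_ : _ = (-1) ^+ f *
    (\sum_(j < N.+1) if (j < p)%N then a p.-1 f else b p f)); last first.
    rewrite sum_ltn_if; last by rewrite -ltnS.
    by rewrite mulrDr; congr (_ + _); exact: mulrCA.
  rewrite mulr_sumr; apply: eq_bigr => j _.
  rewrite (@perm_seq_lift v s) -(@form_split_insert phi psi v) ?szt//; last first.
    by rewrite -ltnS.
  by rewrite odd_lift_perm /= addbF signr_addb signr_odd mulrCA -!mulrA mulrCA.
under eq_bigr do rewrite mulrDr.
rewrite big_split /=; congr (_ + _).
  rewrite big_ord_recl /= mul0r mulr0 add0r; apply: eq_bigr => p _.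
  rewrite /bump /= add1n subSS mulrA; congr (_ * _).
    rewrite factS !natrM; field.
    by rewrite ?nat1r ?natr1 !pnatr_eq0 -!lt0n !fact_gt0.
  by apply: eq_bigr => f _; rewrite /a mulrA.
rewrite big_ord_recr /= subnn mul0r mulr0 addr0; apply: eq_bigr => p _.
have pN : (p <= N)%N by rewrite -ltnS.
rewrite mulrA; congr (_ * _).
  rewrite subSn// factS !natrM; field.
  by rewrite ?nat1r ?natr1 !pnatr_eq0 -!lt0n !fact_gt0.
apply: eq_bigr => f _; rewrite /b /grading /iota size_take_min szt.
by rewrite (minn_idPl pN) !mulrA.
Qed.

Lemma wedgeE phi psi : is_form phi -> is_form psi ->
  wedge phi psi = swedge phi psi.
Proof.
move=> + + ; move=> fphi fpsi; apply/funext => s.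
elim: s phi psi fphi fpsi => [|v s IH] phi psi fphi fpsi.
  rewrite /wedge big_ord1 /= fact0 invr1 mul1r.
  rewrite (bigD1 1%g)//= big1 ?addr0; last first.
    by move=> f /eqP[]; apply/permP => -[].
  by rewrite odd_perm1 mul1r /image_mem enum_ord0.
rewrite wedge_cons// swedge_cons !IH//;
  by try exact: is_form_interior; try exact: is_form_grading.
Qed.

(** * Clifford action *)

Lemma ext_nil xi phi : ext xi phi [::] = 0. Proof. by []. Qed.

Lemma ext_cons xi phi v s :
  ext xi phi (v :: s) = contract v xi * phi s - ext xi (iota v phi) s.
Proof. by []. Qed.

Lemma contractDl u v xi a :
  contract (a *: u + v) xi = a * contract u xi + contract v xi.
Proof.
rewrite /contract mulr_sumr -big_split; apply: eq_bigr => j _ /=.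
by rewrite !mxE; ring.
Qed.

Lemma contractDr u xi eta a :
  contract u (a *: xi + eta) = a * contract u xi + contract u eta.
Proof.
rewrite /contract mulr_sumr -big_split; apply: eq_bigr => j _ /=.
by rewrite !mxE; ring.
Qed.

Lemma contract0l xi : contract 0 xi = 0.
Proof. by rewrite /contract big1// => j _; rewrite mxE mulr0. Qed.

Lemma contract0r v : contract v 0 = 0.
Proof. by rewrite /contract big1// => j _; rewrite mxE mul0r. Qed.

Lemma is_form_covector xi : is_form (covector_form xi).
Proof.
apply: is_form_adjacent.
  move=> [|w [|w' s1]] [|w'' s2] a u v //=; rewrite ?mulr0 ?addr0//.
  exact: contractDl.
by move=> [|w [|w' s1]].
Qed.

Lemma swedge_covector xi phi : swedge (covector_form xi) phi = ext xi phi.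
Proof.
apply/funext => s; elim: s phi => [|v s IH] phi.
  by rewrite ext_nil /swedge /= mul0r.
rewrite swedge_cons ext_cons; congr (_ + _).
  pose c a : form := fun s => if s is [::] then a else 0.
  have -> : iota v (covector_form xi) = c (contract v xi).
    by apply/funext => -[|w l].
  elim: s phi {IH} => [|w s IH] phi; first by rewrite /swedge.
  rewrite swedge_cons (_ : iota w _ = fun=> 0); last by apply/funext.
  rewrite swedge0l add0r (_ : grading _ = c (contract v xi)).
    by rewrite IH.
  apply/funext=> -[|x l]; first by rewrite /grading mul1r.
  by rewrite /grading mulr0.
rewrite -IH (_ : grading _ = fun s => (-1) * covector_form xi s).
  by rewrite swedgeZl mulN1r.
apply/funext=> -[|x [|y l]]; rewrite /grading /= ?mulr0//.
Qed.

Lemma is_form_ext xi phi : is_form phi -> is_form (ext xi phi).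
Proof.
by move=> fphi; rewrite -swedge_covector; apply: is_form_swedge => //;
  exact: is_form_covector.
Qed.

Lemma ext_lincomb xi a phi psi :
  ext xi (lincomb a phi psi) = lincomb a (ext xi phi) (ext xi psi).
Proof. by rewrite -!swedge_covector swedge_lincombr. Qed.

Lemma ext0 xi : ext xi (fun=> 0) = fun=> 0.
Proof. by rewrite -swedge_covector swedge0r. Qed.

Lemma extZ xi a phi s : ext xi (fun s => a * phi s) s = a * ext xi phi s.
Proof. by rewrite -!swedge_covector swedgeZr. Qed.

Lemma ext_lincombl a xi eta phi :
  ext (a *: xi + eta) phi = lincomb a (ext xi phi) (ext eta phi).
Proof.
apply/funext=> s; rewrite /lincomb.
elim: s phi => [|v s IH] phi; first by rewrite !ext_nil mulr0 addr0.
by rewrite !ext_cons IH contractDr; ring.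
Qed.

(** The Clifford action with the recursive exterior multiplication; on alternating
    forms it is [clifford], see [cliffordE]. *)
Definition cl (u : gvec R n) phi : form := fun s => iota u.1 phi s + ext u.2 phi s.

Lemma cliffordE (u : gvec R n) phi : is_form phi -> clifford u phi = cl u phi.
Proof.
move=> fphi; apply/funext=> s; rewrite /clifford /cl wedgeE ?swedge_covector//.
exact: is_form_covector.
Qed.

Lemma is_form_cl (u : gvec R n) phi : is_form phi -> is_form (cl u phi).
Proof.
move=> fphi.
rewrite (_ : cl u phi = lincomb 1 (iota u.1 phi) (ext u.2 phi)).
  by apply: is_form_lincomb; [exact: is_form_interior|exact: is_form_ext].
by apply/funext=> s; rewrite /lincomb mul1r.
Qed.

Lemma cl_lincomb (u : gvec R n) a phi psi :
  cl u (lincomb a phi psi) = lincomb a (cl u phi) (cl u psi).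
Proof.
apply/funext=> s; rewrite {1}/cl ext_lincomb /lincomb /cl /iota; ring.
Qed.

Lemma cl_lincombl (u w : gvec R n) a phi : is_form phi ->
  cl (a *: u + w) phi = lincomb a (cl u phi) (cl w phi).
Proof.
move=> fphi; apply/funext=> s.
by rewrite {1}/cl /= iota_lin// ext_lincombl /lincomb /cl; ring.
Qed.

Lemma ext_skew xi eta phi s : ext xi (ext eta phi) s = - ext eta (ext xi phi) s.
Proof.
elim: s phi => [|v s IH] phi; first by rewrite !ext_nil oppr0.
have E z z' : ext z (iota v (ext z' phi)) s =
    contract v z' * ext z phi s - ext z (ext z' (iota v phi)) s.
  rewrite (_ : iota v _ = lincomb (-1) (ext z' (iota v phi))
    (fun s => contract v z' * phi s)).
    by rewrite ext_lincomb /lincomb extZ; ring.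
  by apply/funext=> t; rewrite /lincomb /iota ext_cons; ring.
by rewrite [LHS]ext_cons [X in _ = - X]ext_cons !E IH; ring.
Qed.

(** Contractions anticommute with each other, exterior multiplications too, and
    i_v (xi /\ phi) + xi /\ i_v phi = xi(v) phi. *)
Lemma cl_anticommute (u w : gvec R n) phi s : is_form phi ->
  cl u (cl w phi) s + cl w (cl u phi) s =
  (contract u.1 w.2 + contract w.1 u.2) * phi s.
Proof.
move=> fphi.
have E (x y : gvec R n) : cl x (cl y phi) s =
    phi [:: y.1, x.1 & s] + contract x.1 y.2 * phi s - ext y.2 (iota x.1 phi) s
    + ext x.2 (iota y.1 phi) s + ext x.2 (ext y.2 phi) s.
  rewrite {1}/cl (_ : cl y phi = lincomb 1 (iota y.1 phi) (ext y.2 phi)).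
    by rewrite ext_lincomb /lincomb /iota ext_cons; ring.
  by apply/funext=> t; rewrite /lincomb mul1r.
by rewrite !E (interior_skew u.1)// (ext_skew u.2); ring.
Qed.

End ExteriorAlgebra.

(** * The pairing and the intersection of annihilators *)

Section Pairing.
Context {R : realType} {n : nat}.
Local Notation C := R[i].
Local Notation V := 'rV[C]_n.
Local Notation form := (mixed_form R n).
Local Notation iota := interior_product.

Implicit Types (phi psi : form) (s : seq V) (u v : V) (xi eta : V).

Lemma not_free_split (vT : vectType C) (s : seq vT) : ~~ free s ->
  exists (s1 : seq vT) (v : vT) (s2 : seq vT), s = s1 ++ v :: s2 /\ v \in span s2.
Proof.
elim: s => [|v s IH]; first by rewrite nil_free.
rewrite free_cons negb_and negbK; have [vs _|_ /=] := boolP (v \in span s).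
  by exists [::], v, s.
by move=> /IH[s1 [w [s2 [-> ws2]]]]; exists (v :: s1), w, s2.
Qed.

(** More than n vectors are dependent: expanding one of them in terms of later ones
    leaves only terms with a repeated argument. *)
Lemma form_degree_gt phi s : is_form phi -> (n < size s)%N -> phi s = 0.
Proof.
move=> fphi ns; have : ~~ free s.
  apply/negP => /eqP fs; move: ns; rewrite -fs ltnNge => /negP; apply.
  rewrite (leq_trans (dimvS (subvf _)))// dimvf. by rewrite dim_matrix mul1r.
move=> /not_free_split[s1 [v [s2 [-> vs2]]]].
have rep w : w \in s2 -> phi (s1 ++ w :: s2) = 0.
  by move=> /(path.splitPr)[t1 t2]; rewrite fphi.2.
rewrite (coord_span (X := in_tuple s2) vs2) form_sum// big1// => i _.
by rewrite formZ// rep ?mulr0// mem_nth.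
Qed.

Lemma grading_ext xi phi :
  grading (ext xi phi) = fun s => - 1 * ext xi (grading phi) s.
Proof.
apply/funext => s; elim: s phi => [|v s IH] phi.
  by rewrite /grading !ext_nil; ring.
have -> : ext xi (grading phi) (v :: s) =
    contract v xi * grading phi s + ext xi (grading (iota v phi)) s.
  by rewrite ext_cons grading_interior ext_lincomb /lincomb ext0; ring.
have := IH (iota v phi); rewrite mulN1r => /(congr1 (@GRing.opp C)).
rewrite opprK => <-; rewrite /grading ext_cons /= exprS; ring.
Qed.

Lemma interior_ext v xi phi :
  iota v (ext xi phi) =
  lincomb (-1) (ext xi (iota v phi)) (fun s => contract v xi * phi s).
Proof. by apply/funext=> s; rewrite /lincomb /iota ext_cons; ring. Qed.

Lemma swedge_extl xi phi psi :
  swedge (ext xi phi) psi = ext xi (swedge phi psi).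
Proof.
apply/funext => s; elim: s phi psi => [|v s IH] phi psi.
  by rewrite ext_nil /swedge /= mul0r.
rewrite swedge_cons ext_cons interior_ext swedge_lincombl /lincomb swedgeZl.
rewrite grading_ext swedgeZl !IH.
rewrite (_ : iota v (swedge phi psi) =
  lincomb 1 (swedge (iota v phi) psi) (swedge (grading phi) (iota v psi))).
  by rewrite ext_lincomb /lincomb; ring.
by apply/funext=> t; rewrite /lincomb /iota swedge_cons mul1r.
Qed.

Lemma swedge_extr xi phi psi :
  swedge phi (ext xi psi) = ext xi (swedge (grading phi) psi).
Proof.
apply/funext => s; elim: s phi psi => [|v s IH] phi psi.
  by rewrite ext_nil /swedge /= mulr0.
rewrite swedge_cons ext_cons interior_ext swedge_lincombr /lincomb swedgeZr.
rewrite !IH (_ : iota v (swedge (grading phi) psi) =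
  lincomb (-1) (swedge (grading (iota v phi)) psi) (swedge phi (iota v psi))).
  by rewrite ext_lincomb /lincomb gradingK; ring.
apply/funext=> t; rewrite /lincomb /iota swedge_cons gradingK grading_interior.
by rewrite swedge_lincombl /lincomb swedge0l addr0.
Qed.

(** Both the homogeneous components and the signed sums of components in the
    pairing are of this kind. *)
Definition weight (a : nat -> C) phi : form := fun s => a (size s) * phi s.

Lemma is_form_weight a phi : is_form phi -> is_form (weight a phi).
Proof.
move=> [lin alt]; split=> [s1 s2 b u w|s1 s2 s3 u]; rewrite /weight.
  rewrite lin !size_cat /=; ring.
by rewrite alt mulr0.
Qed.

Lemma ext_weight xi a phi s :
  ext xi (weight a phi) s = a (size s).-1 * ext xi phi s.
Proof.
elim: s a phi => [|v s IH] a phi; first by rewrite !ext_nil mulr0.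
rewrite !ext_cons (_ : iota v _ = weight (a \o S) (iota v phi))// IH /weight.
by case: s {IH} => [|w s] /=; rewrite ?ext_nil; ring.
Qed.

(** On N arguments only the degrees p and N - p meet, so that a sum of products
    of weighted forms only depends on its total coefficient at each p. *)
Lemma swedge_weight_sum (I : finType) (P : pred I) (c : I -> C)
    (a b : I -> nat -> C) (t : nat -> C) phi psi s :
  (forall p, (p <= size s)%N ->
     \sum_(k | P k) c k * (a k p * b k (size s - p)%N) = t p) ->
  \sum_(k | P k) c k * swedge (weight (a k) phi) (weight (b k) psi) s =
  swedge (weight t phi) psi s.
Proof.
elim: s phi psi a b t => [|v s IH] phi psi a b t H.
  rewrite /swedge /= /weight /=; have H0 := H 0%N isT; rewrite -H0.
  by rewrite mulr_suml mulr_suml; apply: eq_bigr => k _; ring.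
rewrite swedge_cons.
rewrite (_ : iota v (weight t phi) = weight (t \o S) (iota v phi))//.
rewrite (_ : grading (weight t phi) = weight t (grading phi)); last first.
  by apply/funext=> x; rewrite /grading /weight mulrCA.
rewrite -(IH _ _ (fun k => a k \o S) b) => [|p ps]; last by rewrite /= -H.
rewrite -(IH _ _ a (fun k => b k \o S)) => [|p ps]; last first.
  by rewrite -H ?leqW//= subSn.
rewrite -big_split; apply: eq_bigr => k _ /=; rewrite swedge_cons mulrDr.
congr (_ * _ + _ * swedge _ _ _).
by apply/funext=> x; rewrite /grading /weight mulrCA.
Qed.

Lemma componentE k phi : component k phi = weight (fun p => (p == k)%:R) phi.
Proof.
by apply/funext=> s; rewrite /component /weight; case: eqP; rewrite ?mul1r ?mul0r.
Qed.

(** The sign of the degree p component of the first factor in the pairing, with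
    2k = p or 2k + 1 = p. *)
Definition pairing_sign (odd_part : bool) (p : nat) : C :=
  if odd p == odd_part then (-1) ^+ p./2 else 0.

(** Since i_v phi = - xi /\ phi compares degrees that differ by two, the signed form
    tau phi satisfies i_v (tau phi) = xi /\ tau phi. *)
Lemma pairing_signSS b p : pairing_sign b p.+2 = - pairing_sign b p.
Proof. by rewrite /pairing_sign /= negbK; case: eqP; rewrite ?oppr0// exprS mulN1r. Qed.

Lemma wedge_componentE (p q : nat) phi psi : is_form phi -> is_form psi ->
  wedge (component p phi) (component q psi) =
  swedge (weight (fun k => (k == p)%:R) phi) (weight (fun k => (k == q)%:R) psi).
Proof.
by move=> fphi fpsi; rewrite !componentE wedgeE//; exact: is_form_weight.
Qed.

Lemma pairing_sumE (b : bool) phi psi s : is_form phi -> is_form psi ->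
  \sum_(k < n.+1 | (b + k.*2 <= n)%N) (-1) ^+ k *
     wedge (component (b + k.*2) phi) (component (n - (b + k.*2)) psi) s =
  if size s == n then swedge (weight (pairing_sign b) phi) psi s else 0.
Proof.
move=> fphi fpsi; under eq_bigr do rewrite wedge_componentE//.
have [sn|sn] := eqVneq (size s) n; last first.
  rewrite (@swedge_weight_sum _ _ _ _ _ (fun=> 0)).
    rewrite (_ : weight _ _ = fun=> 0); first by rewrite swedge0l.
    by apply/funext=> x; rewrite /weight mul0r.
  move=> p ps; rewrite big1// => k kn; case: eqP => [pk|_]; last by rewrite mul0r mulr0.
  rewrite (_ : (_ == _) = false) ?mulr0//; apply/negbTE; apply: contra sn.
  by rewrite -pk => /eqP; rewrite -pk in kn => E; apply/eqP; lia.
apply: swedge_weight_sum => p; rewrite sn => ps; rewrite /pairing_sign.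
have E k : p = (b + k.*2)%N -> odd p = b /\ p./2 = k.
  by case: b => ->; rewrite ?add1n /= ?add0n ?odd_double ?uphalf_double ?doubleK.
have [pb|pb] := eqVneq (odd p) b; last first.
  rewrite big1// => k kn; case: eqP => [/E[]/eqP|]; last by rewrite mul0r mulr0.
  by rewrite (negbTE pb).
have p2 : (p./2 < n.+1)%N by lia.
have pE : (b + (Ordinal p2).*2)%N = p by rewrite -pb odd_double_half.
rewrite (bigD1 (Ordinal p2)) ?pE//= !eqxx !mulr1 big1 ?addr0// => k /andP[_ kp].
case: eqP => [/E[_ pk]|]; last by rewrite mul0r mulr0.
by case/eqP: kp; apply/val_inj; rewrite /= pk.
Qed.

Lemma exists_dual v : v != 0 -> exists xi, contract v xi = 1.
Proof.
move=> /rV0Pn[j vj]; exists ((v 0 j)^-1 *: delta_mx 0 j).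
rewrite /contract (bigD1 j)//= big1 ?addr0 ?mxE ?eqxx ?mulr1 ?mulVf// => i ij.
by rewrite !mxE eqxx (negbTE ij) /= mulr0 mul0r.
Qed.

Lemma contract_sym v xi : contract v xi = contract xi v.
Proof. by apply: eq_bigr => j _; exact: mulrC. Qed.

(** If v <> 0 then i_v Om = 0 for the signed wedge product Om, hence
    Om = i_v (eta /\ Om) whenever eta(v) = 1, and eta /\ Om is zero for degree
    reasons. If v = 0 then phi = xi /\ i_w phi with xi(w) = 1, and xi can be moved
    next to psi, which it kills. *)
Lemma common_annihilator_swedge (u : gvec R n) b phi psi s :
  is_form phi -> is_form psi -> u <> 0 ->
  cl u phi = (fun=> 0) -> cl u psi = (fun=> 0) -> size s = n ->
  swedge (weight (pairing_sign b) phi) psi s = 0.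
Proof.
move=> fphi fpsi; case: u => v xi u0 uphi upsi sn.
have E (chi : form) : cl (v, xi) chi = (fun=> 0) ->
    iota v chi = fun s => -1 * ext xi chi s.
  move=> e; apply/funext => t; apply/eqP; rewrite -subr_eq0 mulN1r opprK.
  exact/eqP/(congr1 (@^~ t) e).
have [v0|v0] := eqVneq v 0; last first.
  set Om := swedge _ _.
  have fOm : is_form Om by apply: is_form_swedge => //; exact: is_form_weight.
  have iOm : iota v Om = fun=> 0.
    apply/funext=> t; rewrite /iota /Om swedge_cons (E psi)//.
    rewrite (_ : iota v (weight _ phi) = ext xi (weight (pairing_sign b) phi)).
      rewrite swedge_extl swedgeZr swedge_extr gradingK; ring.
    apply/funext=> r; rewrite ext_weight /iota /weight /= -/(iota v phi r) (E phi)//.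
    case: r => [|w r]; first by rewrite ext_nil !mulr0.
    by rewrite /= pairing_signSS; ring.
  have [eta veta] := exists_dual v0.
  have : ext eta Om (v :: s) = 0.
    by apply: form_degree_gt; [exact: is_form_ext|rewrite /= sn].
  by rewrite ext_cons veta iOm ext0 subr0 mul1r.
have xi0 : xi != 0 by apply/eqP => x0; apply: u0; rewrite v0 x0.
have [w wxi] := exists_dual xi0; rewrite contract_sym in wxi.
have F chi : is_form chi -> cl (v, xi) chi = (fun=> 0) -> ext xi chi = fun=> 0.
  move=> fchi e; apply/funext=> t; rewrite -[RHS](congr1 (@^~ t) e) /cl /= v0.
  by rewrite /iota (form0 [::])// add0r.
have -> : phi = ext xi (iota w phi).
  apply/funext=> t; have := congr1 (@^~ (w :: t)) (F _ fphi uphi).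
  by rewrite /= ext_cons wxi mul1r => /eqP; rewrite subr_eq0 => /eqP.
have -> : weight (pairing_sign b) (ext xi (iota w phi)) =
    ext xi (weight (fun p => pairing_sign b p.+1) (iota w phi)).
  apply/funext=> t; rewrite ext_weight /weight.
  by case: t => [|x t] //; rewrite ext_nil !mulr0.
set a := weight _ _; rewrite swedge_extl -{1}(gradingK a) -swedge_extr F//.
by rewrite swedge0r.
Qed.

Lemma common_annihilator_pairing (u : gvec R n) phi psi :
  is_form phi -> is_form psi -> u <> 0 ->
  cl u phi = (fun=> 0) -> cl u psi = (fun=> 0) ->
  pairing_even phi psi = cst 0 /\ pairing_odd phi psi = cst 0.
Proof.
move=> fphi fpsi u0 uphi upsi.
have H (b : bool) s : \sum_(k < n.+1 | (b + k.*2 <= n)%N) (-1) ^+ k *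
     wedge (component (b + k.*2) phi) (component (n - (b + k.*2)) psi) s = 0.
  rewrite pairing_sumE//; case: eqP => // sn.
  exact: (common_annihilator_swedge b fphi fpsi u0).
by split; apply/funext => s; [exact: (H false)|exact: (H true)].
Qed.

(** * Conjugation *)

Lemma conjgD (u w : gvec R n) : conjg (u + w) = conjg u + conjg w.
Proof. by rewrite /conjg /= !map_mxD. Qed.

Lemma conjgZ a (u : gvec R n) : conjg (a *: u) = conjc a *: conjg u.
Proof. by rewrite /conjg /= !map_mxZ. Qed.

Lemma conjgK : involutive (@conjg R n).
Proof.
move=> [v xi]; rewrite /conjg /= -!map_mx_comp; congr (_, _);
by apply/matrixP=> i j; rewrite !mxE /= conjcK.
Qed.

Lemma conjg0 : conjg 0 = 0 :> gvec R n.
Proof. by rewrite /conjg /= !map_mx0. Qed.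

Lemma contract_conj v xi :
  contract (map_mx conjc v) (map_mx conjc xi) = conjc (contract v xi).
Proof.
by rewrite /contract rmorph_sum; apply: eq_bigr => j _; rewrite rmorphM !mxE.
Qed.

Lemma is_form_conj phi : is_form phi -> is_form (conj_form phi).
Proof.
move=> [lin alt]; split=> [s1 s2 a u w|s1 s2 s3 u]; rewrite /conj_form.
  rewrite !map_cat /= map_mxD map_mxZ lin rmorphD rmorphM /=.
  by rewrite conjcK.
by rewrite !map_cat /= map_cat /= alt conjc0.
Qed.

Lemma ext_conj xi phi :
  ext (map_mx conjc xi) (conj_form phi) = conj_form (ext xi phi).
Proof.
apply/funext => s; elim: s phi => [|v s IH] phi.
  rewrite /conj_form /= !ext_nil. by rewrite oppr0.
rewrite /conj_form /= !ext_cons rmorphB rmorphM /= -contract_conj.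
congr (_ * _ - _).
  congr contract; apply/matrixP=> i j; rewrite !mxE.
  by rewrite conjcK.
exact: (IH (iota (map_mx conjc v) phi)).
Qed.

Lemma cl_conj (u : gvec R n) phi :
  cl (conjg u) (conj_form phi) = conj_form (cl u phi).
Proof.
apply/funext=> s; rewrite /cl ext_conj /conj_form /iota /= rmorphD /=.
congr (conjc (phi (_ :: _)) + _); apply/matrixP=> i j; rewrite !mxE.
by rewrite conjcK.
Qed.

Lemma dim_gvec : \dim {:gvec R n} = (n + n)%N.
Proof.
rewrite dimvf; transitivity (1 * n + 1 * n)%N; last by rewrite mul1n.
exact: erefl.
Qed.

(** Dimension count: the conjugate of a basis is free, and n + n is the dimension
    of the whole space. *)
Lemma conjg_decomposition (U : {vspace gvec R n}) : \dim U = n ->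
  (forall u : gvec R n, u \in U -> conjg u \in U -> u = 0) ->
  forall w, exists u v : gvec R n, [/\ u \in U, v \in U & w = u + conjg v].
Proof.
move=> dU disj w; pose X := vbasis U; pose Y := [tuple of map (@conjg R n) X].
have conjY (k : 'I_(\dim U) -> C) :
    \sum_i k i *: Y`_i = conjg (\sum_i conjc (k i) *: X`_i).
  rewrite (big_morph _ conjgD conjg0); apply: eq_bigr => i _.
  by rewrite conjgZ /= conjcK (nth_map 0) // size_tuple.
have fY : free Y.
  apply/freeP=> k; rewrite conjY => /(congr1 (@conjg R n)); rewrite conjgK conjg0.
  move=> Xk i; have /freeP /(_ _ Xk) k0 := basis_free (vbasisP U).
  by have := k0 i => /(congr1 (@conjc R)); rewrite conjcK conjc0.
have Yconj (v : gvec R n) : v \in <<Y>>%VS -> conjg v \in U.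
  move=> /coord_span ->; rewrite conjY conjgK.
  by rewrite memv_suml// => i _; rewrite memvZ// vbasis_mem// mem_nth// size_tuple.
have UY : (U :&: <<Y>> = 0)%VS.
  apply/eqP; rewrite -subv0; apply/subvP=> v; rewrite memv_cap memv0 => /andP[vU vY].
  by apply/eqP; apply: disj => //; exact: Yconj.
have : w \in (U + <<Y>>)%VS.
  have /eqP -> : (U + <<Y>> == fullv)%VS; last exact: memvf.
  rewrite eqEdim subvf dim_gvec dimv_disjoint_sum//.
  by move: fY => /eqP ->; rewrite size_tuple dU leqnn.
move=> /memv_addP[u uU [v vY ->]]; exists u, (conjg v); split=> //.
  exact: Yconj.
by rewrite conjgK.
Qed.
End Pairing.

(** * Symmetry of second derivatives *)

Section RealCalculus.
Context {R : realType} {V : normedModType R}.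

(** The difference g - f is zero near x, so zero is its differential. *)
Lemma near_eq_differentiable (W : normedModType R) (f g : V -> W) (x : V) :
  {near x, f =1 g} -> differentiable f x -> differentiable g x.
Proof.
move=> fg df.
have gx : f x = g x by exact: nbhs_singleton fg.
pose h := g - f.
suff dh : differentiable h x by rewrite -[g](subrK f); exact: differentiableD.
have E : h \o shift x = cst (h x) + (\0%R : {linear V -> W}) +o_ 0 id.
  apply/eqaddoP => e e0; move: fg; rewrite (near_shift 0) subr0 /= => fg.
  near=> y.
  have fgy : f (y + x) = g (y + x) by near: y; exact: fg.
  rewrite !fctE /h /= !fctE /= gx subrr addr0 fgy subrr subr0 normr0.
  by rewrite mulr_ge0// ltW.
have c0 : continuous (\0%R : {linear V -> W}) by move=> y; exact: cvg_cst.
by apply/diff_locallyP; rewrite (diff_unique c0 E).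
Unshelve. all: by end_near. Qed.

Lemma derive_line (f : V -> R) (a v : V) (t : R) :
  differentiable f (a + t *: v) ->
  is_derive t 1 (fun s => f (a + s *: v)) ('D_v f (a + t *: v)).
Proof.
move=> df; pose l (s : R) : V := a + s *: v.
have dl : is_diff t l (fun s => s *: v).
  have := is_diffD (is_diff_cst a t) (is_diff_scalel t v).
  by rewrite add0r; apply.
have dfl : differentiable (f \o l) t by exact: differentiable_comp.
apply: DeriveDef; first exact: diff_derivable.
rewrite (deriveE _ dfl) (deriveE _ df) diff_comp//= diff_val.
by rewrite scale1r.
Qed.

Let second_difference (f : V -> R) x u v (h : R) :=
  f (x + h *: u + h *: v) - f (x + h *: u) - f (x + h *: v) + f x.

(** By the mean value theorem in the direction u, the second difference is
    h ('D_u f (x + hv + cu) - 'D_u f (x + cu)), and the differentiability of 'D_u f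
    at x replaces the difference by h times its derivative along v. *)
Lemma second_difference_derive (f : V -> R) x (u v : V) (e : R) : 0 < e ->
  (\forall y \near x, differentiable f y) -> differentiable ('D_u f) x ->
  \forall h \near 0^'+, `|second_difference f x u v h -
    h ^+ 2 * 'D_v ('D_u f) x| <= e * h ^+ 2.
Proof.
move=> e0 df dDf; 
(* K h bounds the two increments c u + h v and c u together. *)
pose K := `|u| + `|u| + `|v| + 1.
have K0 : 0 < K by rewrite ltr_wpDl// !addr_ge0.
pose e' := e / K; have e'0 : 0 < e' by rewrite divr_gt0.
have /nbhs_ballP[r /= r0 rP] := df.
have [r' /= r'0 r'P] : exists2 r', 0 < r' & forall w, `|w| < r' ->
    `|'D_u f (x + w) - 'D_u f x - 'd ('D_u f) x w| <= e' * `|w|.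
  have /diff_locally/eqaddoP /(_ e' e'0) /nbhs_ballP[r' /= r'0 H] := dDf.
  exists r' => // w wr'; have := H w.
  rewrite -ball_normE /= sub0r normrN => /(_ wr').
  by rewrite !fctE /= (addrC w) opprD addrA.
pose d := Num.min r r' / K.
have d0 : 0 < d by rewrite divr_gt0// lt_min r0.
near=> h.
have h0 : 0 < h by near: h; exact: nbhs_right_gt.
have hd : h < d by near: h; exact: nbhs_right_lt.
have small a b : 0 <= a <= h -> 0 <= b <= h ->
    `|a *: u + b *: v| < r /\ `|a *: u + b *: v| < r'.
  move=> /andP[a0 ah] /andP[b0 bh]; apply/andP; rewrite -lt_min.
  rewrite (le_lt_trans (ler_normD _ _))// !normrZ (ger0_norm a0) (ger0_norm b0).
  have : h * K < Num.min r r' by rewrite -ltr_pdivlMr.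
  apply: le_lt_trans; rewrite /K !mulrDr.
  have := ler_wpM2r (normr_ge0 u) ah; have := ler_wpM2r (normr_ge0 v) bh.
  have : 0 <= h * `|u| by rewrite mulr_ge0// ltW.
  lra.
have fdiff a b : 0 <= a <= h -> 0 <= b <= h ->
    differentiable f (x + a *: u + b *: v).
  move=> ah bh; apply: rP; rewrite -ball_normE /= -addrA opprD addrA subrr sub0r normrN.
  by have [] := small a b ah bh.
have hh : 0 <= h <= h by rewrite lexx ltW.
have z0h : 0 <= (0:R) <= h by rewrite lexx ltW.
pose g t := f (x + h *: v + t *: u) - f (x + t *: u).
have dg t : 0 <= t <= h -> is_derive t 1 g
    ('D_u f (x + h *: v + t *: u) - 'D_u f (x + t *: u)).
  move=> th; apply: is_deriveB; apply: derive_line.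
    by rewrite addrAC; exact: fdiff.
  by have := fdiff t 0 th z0h; rewrite scale0r addr0.
have [c ch gE] : exists2 c, c \in `]0, h[%R & g h - g 0 =
    ('D_u f (x + h *: v + c *: u) - 'D_u f (x + c *: u)) * (h - 0).
  apply: (@MVT R g
    (fun t => 'D_u f (x + h *: v + t *: u) - 'D_u f (x + t *: u)) 0 h) => //.
    by move=> t; rewrite in_itv /= => /andP[t0 th]; apply: dg; rewrite !ltW.
  apply: derivable_within_continuous => t; rewrite in_itv /= => th.
  exact: (@ex_derive _ _ _ _ _ _ _ (dg t th)).
have {}ch : 0 <= c <= h by move: ch; rewrite in_itv /= => /andP[? ?]; rewrite !ltW.
have -> : second_difference f x u v h = g h - g 0.
  by rewrite /second_difference /g !scale0r !addr0 (addrAC x); ring.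
rewrite gE subr0 (deriveE _ dDf).
have E1 := r'P _ (small c h ch hh).2.
have E2 : `|'D_u f (x + c *: u) - 'D_u f x - 'd ('D_u f) x (c *: u)| <=
   e' * `|c *: u|.
  by apply: r'P; have := (small c 0 ch z0h).2; rewrite scale0r addr0.
move: E1; rewrite addrA (addrAC x) linearD [in 'd _ _ (h *: v)]linearZ /=.
set A := 'D_u f (x + h *: v + c *: u); set B := 'D_u f (x + c *: u) in E2 *.
set L := 'd ('D_u f) x v => E1.
have {}E1 : `|A - B - h *: L| <= e' * `|c *: u + h *: v| + e' * `|c *: u|.
  apply: le_trans (lerD E1 E2); apply: le_trans (ler_normB _ _).
  rewrite le_eqVlt; apply/orP; left; apply/eqP; congr (`|_|).
  by rewrite /GRing.scale /=; ring.
have -> : (A - B) * h - h ^+ 2 * L = (A - B - h *: L) * h.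
  by rewrite /GRing.scale /=; ring.
rewrite normrM (gtr0_norm h0) expr2 mulrA ler_pM2r//.
apply: le_trans E1 _; rewrite -mulrDr /e' mulrAC ler_pdivrMr//.
rewrite -!mulrA ler_pM2l//.
have := ler_normD (c *: u) (h *: v); rewrite !normrZ (gtr0_norm h0).
case/andP: ch => c0 ch; rewrite (ger0_norm c0) /K !mulrDr => T.
have := ler_wpM2r (normr_ge0 u) ch.
lra.
Unshelve. all: by end_near. Qed.

(** Both mixed derivatives are the limit of the same symmetric second difference
    quotient. *)
Lemma derive_swap (f : V -> R) x (u v : V) :
  (\forall y \near x, differentiable f y) ->
  differentiable ('D_u f) x -> differentiable ('D_v f) x ->
  'D_v ('D_u f) x = 'D_u ('D_v f) x.
Proof.
move=> df du dv; apply/eqP; rewrite -subr_eq0 -normr_le0.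
apply/ler_addgt0Pl => e e0; rewrite addr0.
have e20 : 0 < e / 2 by rewrite divr_gt0.
have H1 := second_difference_derive v e20 df du.
have H2 := second_difference_derive u e20 df dv.
have [|h [[A1 A2] h0]] := @filter_ex _ (0 : R)^'+ _
  [set h | (`|second_difference f x u v h - h ^+ 2 * 'D_v ('D_u f) x|
              <= e / 2 * h ^+ 2 /\
            `|second_difference f x v u h - h ^+ 2 * 'D_u ('D_v f) x|
              <= e / 2 * h ^+ 2) /\ 0 < h].
  apply: filterI; last exact: nbhs_right_gt.
  by apply: filterI; [exact: H1|exact: H2].
have sym : second_difference f x u v h = second_difference f x v u h.
  by rewrite /second_difference (addrAC x); ring.
rewrite sym in A1.
have h20 : 0 < h ^+ 2 by rewrite exprn_gt0.
rewrite -(ler_pM2r h20) -{1}(gtr0_norm h20) -normrM.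
rewrite [in leRHS](splitr e) [leRHS]mulrDl.
rewrite distrC in A1; apply: le_trans (lerD A2 A1).
apply: le_trans (ler_normD _ _); rewrite le_eqVlt; apply/orP; left; apply/eqP.
congr (`|_|); move: (second_difference _ _ _ _ _) ('D_v _ x) ('D_u _ x) => a b d.
by ring.
Qed.
End RealCalculus.

(** * Calculus of complex-valued functions *)

Section ComplexCalculus.
Context {R : realType} {n : nat}.
Local Notation C := R[i].
Local Notation V := 'rV[R]_n.
Implicit Types (f g : V -> C) (x : V) (U : set V) (j : 'I_n).

Definition cdiff f x :=
  differentiable (fun y => complex.Re (f y)) x /\
  differentiable (fun y => complex.Im (f y)) x.

Lemma complex_ReD (z w : C) : complex.Re (z + w) = complex.Re z + complex.Re w.
Proof. by case: z; case: w. Qed.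
Lemma complex_ImD (z w : C) : complex.Im (z + w) = complex.Im z + complex.Im w.
Proof. by case: z; case: w. Qed.
Lemma complex_ReM (z w : C) : complex.Re (z * w) =
  complex.Re z * complex.Re w - complex.Im z * complex.Im w.
Proof. by case: z; case: w. Qed.
Lemma complex_ImM (z w : C) : complex.Im (z * w) =
  complex.Re z * complex.Im w + complex.Im z * complex.Re w.
Proof. by case: z; case: w. Qed.

Lemma complex_eq (z w : C) : complex.Re z = complex.Re w ->
  complex.Im z = complex.Im w -> z = w.
Proof. by case: z w => [a b] [c d] /= -> ->. Qed.

Lemma near_eq_cdiff f g x : {near x, f =1 g} -> cdiff f x -> cdiff g x.
Proof.
move=> fg [d1 d2]; split.
  by apply: near_eq_differentiable d1; apply: filterS fg => y ->.
by apply: near_eq_differentiable d2; apply: filterS fg => y ->.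
Qed.

Lemma near_eq_cpartial f g x j :
  {near x, f =1 g} -> cpartial j f x = cpartial j g x.
Proof.
move=> fg; apply: complex_eq; apply: near_eq_derive; apply: filterS fg => y ->//.
Qed.

Lemma cpartial_real (h : V -> R) x j :
  cpartial j (fun y => (h y)%:C%C) x = (partial j h x)%:C%C.
Proof. by apply: complex_eq => //=; exact: derive_cst. Qed.

Lemma cdiff_cst c x : cdiff (fun=> c) x.
Proof. by split; exact: differentiable_cst. Qed.

Lemma cpartial_cst c x j : cpartial j (fun=> c) x = 0.
Proof. by apply: complex_eq => /=; exact: derive_cst. Qed.

Lemma cdiffD f g x : cdiff f x -> cdiff g x -> cdiff (fun y => f y + g y) x.
Proof.
move=> [f1 f2] [g1 g2]; split.
  by under eq_fun do rewrite complex_ReD; exact: differentiableD.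
by under eq_fun do rewrite complex_ImD; exact: differentiableD.
Qed.

Lemma cpartialD f g x j : cdiff f x -> cdiff g x ->
  cpartial j (fun y => f y + g y) x = cpartial j f x + cpartial j g x.
Proof.
move=> [f1 f2] [g1 g2]; apply: complex_eq;
  rewrite ?complex_ReD ?complex_ImD /= /partial.
  under eq_fun do rewrite complex_ReD.
  by rewrite deriveD//; exact: diff_derivable.
under eq_fun do rewrite complex_ImD.
by rewrite deriveD//; exact: diff_derivable.
Qed.

Lemma cdiffM f g x : cdiff f x -> cdiff g x -> cdiff (fun y => f y * g y) x.
Proof.
move=> [f1 f2] [g1 g2]; split.
  under eq_fun do rewrite complex_ReM.
  by apply: differentiableB; exact: differentiableM.
under eq_fun do rewrite complex_ImM.
by apply: differentiableD; exact: differentiableM.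
Qed.

Lemma cpartialM f g x j : cdiff f x -> cdiff g x ->
  cpartial j (fun y => f y * g y) x = cpartial j f x * g x + f x * cpartial j g x.
Proof.
move=> [f1 f2] [g1 g2].
have D (h k : V -> R) : differentiable h x -> differentiable k x ->
    'D_(delta_mx 0 j) (fun y => h y * k y) x =
    'D_(delta_mx 0 j) h x * k x + h x * 'D_(delta_mx 0 j) k x.
  move=> dh dk; rewrite deriveM; [|exact: diff_derivable..].
  by rewrite /GRing.scale /= addrC mulrC.
apply: complex_eq;
  rewrite ?complex_ReD ?complex_ImD ?complex_ReM ?complex_ImM /= /partial.
  under eq_fun do rewrite complex_ReM.
  rewrite (@deriveB _ _ _ (fun y => complex.Re (f y) * complex.Re (g y))
    (fun y => complex.Im (f y) * complex.Im (g y)));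
    [|exact/diff_derivable/differentiableM..].
  by rewrite !D//; ring.
under eq_fun do rewrite complex_ImM.
rewrite (@deriveD _ _ _ (fun y => complex.Re (f y) * complex.Im (g y))
    (fun y => complex.Im (f y) * complex.Re (g y)));
  [|exact/diff_derivable/differentiableM..].
by rewrite !D//; ring.
Qed.

Lemma cdiffZ a f x : cdiff f x -> cdiff (fun y => a * f y) x.
Proof. by move=> df; apply: cdiffM => //; exact: cdiff_cst. Qed.

Lemma cpartialZ a f x j : cdiff f x ->
  cpartial j (fun y => a * f y) x = a * cpartial j f x.
Proof.
by move=> df; rewrite cpartialM ?cpartial_cst ?mul0r ?add0r//; exact: cdiff_cst.
Qed.

Lemma cdiffN f x : cdiff f x -> cdiff (fun y => - f y) x.
Proof. by move=> /(cdiffZ (-1)); under eq_fun do rewrite mulN1r. Qed.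

Lemma cpartialN f x j : cdiff f x ->
  cpartial j (fun y => - f y) x = - cpartial j f x.
Proof.
move=> /(cpartialZ (-1) j); under eq_fun do rewrite mulN1r.
by rewrite mulN1r.
Qed.

Lemma cdiffB f g x : cdiff f x -> cdiff g x -> cdiff (fun y => f y - g y) x.
Proof. by move=> df dg; apply: cdiffD => //; exact: cdiffN. Qed.

Lemma cpartialB f g x j : cdiff f x -> cdiff g x ->
  cpartial j (fun y => f y - g y) x = cpartial j f x - cpartial j g x.
Proof. by move=> df dg; rewrite cpartialD ?cpartialN//; exact: cdiffN. Qed.

Lemma cdiff_sum (I : Type) (r : seq I) (P : pred I) (F : I -> V -> C) x :
  (forall i, cdiff (F i) x) -> cdiff (fun y => \sum_(i <- r | P i) F i y) x.
Proof.
move=> dF; elim: r => [|i r IH].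
  by under eq_fun do rewrite big_nil; exact: cdiff_cst.
under eq_fun do rewrite big_cons; case: (P i) => //.
exact: cdiffD.
Qed.

Lemma cpartial_sum (I : Type) (r : seq I) (P : pred I) (F : I -> V -> C) x j :
  (forall i, cdiff (F i) x) ->
  cpartial j (fun y => \sum_(i <- r | P i) F i y) x =
  \sum_(i <- r | P i) cpartial j (F i) x.
Proof.
move=> dF; elim: r => [|i r IH].
  by under eq_fun do rewrite big_nil; rewrite big_nil cpartial_cst.
under eq_fun do rewrite big_cons; rewrite big_cons; case: (P i) => //.
by rewrite cpartialD ?IH//; exact: cdiff_sum.
Qed.

Lemma cdiffV f x : f x != 0 -> cdiff f x -> cdiff (fun y => (f y)^-1) x.
Proof.
move=> fx0 [f1 f2].
pose N y := complex.Re (f y) * complex.Re (f y) + complex.Im (f y) * complex.Im (f y).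
have dN : differentiable N x.
  by apply: differentiableD; exact: differentiableM.
have N0 : N x != 0.
  rewrite /N -!expr2 paddr_eq0 ?sqr_ge0// !sqrf_eq0; move: fx0.
  by case: (f x) => a b /=; rewrite eq_complex.
have dV : differentiable (fun y => (N y)^-1) x by exact: differentiableV.
have E y : (f y)^-1 = (complex.Re (f y) * (N y)^-1 +i*
                       (- (complex.Im (f y) * (N y)^-1)))%C.
  by rewrite /N -!expr2; case: (f y) => a b.
by split; under eq_fun do rewrite E /=;
  [exact: differentiableM|apply: differentiableN; exact: differentiableM].
Qed.

Lemma cdiff_near_neq0 f x : cdiff f x -> f x != 0 -> \forall y \near x, f y != 0.
Proof.
move=> [/differentiable_continuous f1 /differentiable_continuous f2] fx0.
have E y : (f y != 0) = (complex.Re (f y) != 0) || (complex.Im (f y) != 0).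
  by case: (f y) => a b; rewrite eq_complex /= negb_and.
have H (h : V -> R) : {for x, continuous h} -> h x != 0 -> \forall y \near x, h y != 0.
  move=> ch hx; apply: (ch [set z | z != 0]).
  by apply: open_nbhs_nbhs; split=> //; exact: open_neq.
move: fx0; rewrite E => /orP[/(H _ f1)|/(H _ f2)]; apply: filterS => y;
by rewrite E => ->; rewrite ?orbT.
Qed.

(** Differentiate f * f^-1 = 1. *)
Lemma cpartialV f x j : f x != 0 -> cdiff f x ->
  cpartial j (fun y => (f y)^-1) x = - ((f x)^-1 * (f x)^-1 * cpartial j f x).
Proof.
move=> fx0 df.
have : cpartial j (fun y => f y * (f y)^-1) x = 0.
  rewrite -(cpartial_cst 1 x j); apply: near_eq_cpartial.
  by apply: filterS (cdiff_near_neq0 df fx0) => y /mulfV.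
rewrite cpartialM//; last exact: cdiffV.
move=> /(congr1 (fun z => (f x)^-1 * z)); rewrite mulr0 mulrDr mulKf// => /eqP.
rewrite addrC addr_eq0 => /eqP ->; congr (- _); ring.
Qed.

(** Differentiability up to order k, taking the innermost partial derivative first:
    the product, quotient and chain rules then give the closure properties of
    smooth functions by induction on k. *)
Fixpoint smooth_order (k : nat) U f : Prop :=
  (forall x, U x -> cdiff f x) /\
  (if k is k'.+1 then forall j, smooth_order k' U (cpartial j f) else True).

Lemma smooth_orderS k U f : smooth_order k.+1 U f -> smooth_order k U f.
Proof.
elim: k f => [|k IH] f; first by case.
by move=> [df dp]; split=> // j; apply: IH; exact: dp.
Qed.

Lemma foldr_partialE f (s : seq 'I_n) :
  (foldr partial (fun y => complex.Re (f y)) s =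
     fun y => complex.Re (foldr cpartial f s y)) /\
  (foldr partial (fun y => complex.Im (f y)) s =
     fun y => complex.Im (foldr cpartial f s y)).
Proof. by elim: s => [|j s [IH1 IH2]] //=; rewrite IH1 IH2. Qed.

Lemma csmooth_onP U f : csmooth_on U f <-> forall k, smooth_order k U f.
Proof.
have E k h : smooth_order k U h <-> forall s x, (size s <= k)%N -> U x ->
    cdiff (foldr cpartial h s) x.
  elim: k h => [|k IH] h /=; split.
  - by move=> [dh _] [|j s] x // _ /dh.
  - by move=> H; split=> // x Ux; exact: (H [::]).
  - move=> [dh dp]; elim/last_ind => [|s j _] x; first by move=> _ /dh.
    by rewrite size_rcons ltnS foldr_rcons => sk; exact: (IH _).1.
  - move=> H; split; first by move=> x; exact: (H [::]).
    move=> j; apply/IH => s x sk; rewrite -foldr_rcons; apply: H.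
    by rewrite size_rcons.
split.
  move=> [H1 H2] k; apply/E => s x _ Ux; have [E1 E2] := foldr_partialE f s.
  by split; [rewrite -E1; exact: H1|rewrite -E2; exact: H2].
move=> H; split=> s x Ux; have [E1 E2] := foldr_partialE f s.
  by rewrite E1; have /E/(_ s x (leqnn _) Ux)[] := H (size s).
by rewrite E2; have /E/(_ s x (leqnn _) Ux)[] := H (size s).
Qed.

Lemma csmooth_on_cdiff U f x : csmooth_on U f -> U x -> cdiff f x.
Proof. by move=> /csmooth_onP/(_ 0%N)[df _] /df. Qed.

Lemma csmooth_on_cpartial U f j : csmooth_on U f -> csmooth_on U (cpartial j f).
Proof. by move=> /csmooth_onP H; apply/csmooth_onP => k; have [_] := H k.+1; apply. Qed.

Lemma csmooth_on_sub U U' f : U' `<=` U -> csmooth_on U f -> csmooth_on U' f.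
Proof. by move=> UU [f1 f2]; split=> s x /UU; [exact: f1|exact: f2]. Qed.

Section OpenDomain.
Variable U : set V.
Hypothesis oU : open U.

Lemma open_near_eq f g x : (forall y, U y -> f y = g y) -> U x -> {near x, f =1 g}.
Proof.
move=> fg Ux; have : nbhs x U by exact: open_nbhs_nbhs.
by apply: filterS => y /fg.
Qed.

Lemma smooth_order_eq k f g : (forall x, U x -> f x = g x) ->
  smooth_order k U f -> smooth_order k U g.
Proof.
elim: k f g => [|k IH] f g fg [df dp]; split=> //.
- by move=> x Ux; apply: near_eq_cdiff (df _ Ux); exact: open_near_eq.
- by move=> x Ux; apply: near_eq_cdiff (df _ Ux); exact: open_near_eq.
- move=> j; apply: IH (dp j) => x Ux; apply: near_eq_cpartial.
  exact: open_near_eq.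
Qed.

Lemma smooth_order_cst k c : smooth_order k U (fun=> c).
Proof.
elim: k c => [|k IH] c; split=> //; try by move=> x _; exact: cdiff_cst.
move=> j; rewrite (_ : cpartial j _ = fun=> 0)//.
by apply/funext => x; exact: cpartial_cst.
Qed.

Lemma smooth_orderD k f g : smooth_order k U f -> smooth_order k U g ->
  smooth_order k U (fun x => f x + g x).
Proof.
elim: k f g => [|k IH] f g [df pf] [dg pg]; split=> //;
  try (by move=> x Ux; apply: cdiffD; auto); move=> j.
apply: smooth_order_eq (IH _ _ (pf j) (pg j)) => x Ux.
by rewrite cpartialD; [|exact: df|exact: dg].
Qed.

Lemma smooth_order_sum k (I : Type) (r : seq I) (P : pred I) (F : I -> V -> C) :
  (forall i, smooth_order k U (F i)) ->
  smooth_order k U (fun x => \sum_(i <- r | P i) F i x).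
Proof.
move=> sF; elim: r => [|i r IH].
  by under eq_fun do rewrite big_nil; exact: smooth_order_cst.
under eq_fun do rewrite big_cons; case: (P i) => //.
exact: smooth_orderD.
Qed.

Lemma smooth_orderM k f g : smooth_order k U f -> smooth_order k U g ->
  smooth_order k U (fun x => f x * g x).
Proof.
elim: k f g => [|k IH] f g sf sg; have [df pf] := sf; have [dg pg] := sg;
  split=> //; try (by move=> x Ux; apply: cdiffM; auto); move=> j.
apply: (@smooth_order_eq _ (fun x => cpartial j f x * g x + f x * cpartial j g x)).
  by move=> x Ux; rewrite [RHS]cpartialM; [|exact: df|exact: dg].
have [sf' sg'] := (smooth_orderS sf, smooth_orderS sg).
apply: smooth_orderD; apply: IH => //; [exact: pf|exact: pg].
Qed.

Lemma smooth_orderV k f : (forall x, U x -> f x != 0) -> smooth_order k U f ->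
  smooth_order k U (fun x => (f x)^-1).
Proof.
move=> f0; elim: k => [|k IH] sf; have [df pf] := sf;
  split=> //; try (by move=> x Ux; apply: cdiffV; auto); move=> j.
apply: (@smooth_order_eq _ (fun x => -1 * ((f x)^-1 * (f x)^-1 * cpartial j f x))).
  by move=> x Ux; rewrite mulN1r cpartialV; [|exact: f0|exact: df].
apply: smooth_orderM; first exact: smooth_order_cst.
have sV : smooth_order k U (fun x => (f x)^-1) by apply: IH; exact: smooth_orderS.
by apply: smooth_orderM; [exact: smooth_orderM|exact: pf].
Qed.

Lemma csmooth_on_eq f g : (forall x, U x -> f x = g x) ->
  csmooth_on U f -> csmooth_on U g.
Proof.
by move=> fg /csmooth_onP sf; apply/csmooth_onP => k; exact: smooth_order_eq fg _.
Qed.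

Lemma csmooth_on_cst c : csmooth_on U (fun=> c).
Proof. by apply/csmooth_onP => k; exact: smooth_order_cst. Qed.

Lemma csmooth_onD f g : csmooth_on U f -> csmooth_on U g ->
  csmooth_on U (fun x => f x + g x).
Proof.
move=> /csmooth_onP sf /csmooth_onP sg; apply/csmooth_onP => k.
exact: smooth_orderD.
Qed.

Lemma csmooth_onM f g : csmooth_on U f -> csmooth_on U g ->
  csmooth_on U (fun x => f x * g x).
Proof.
move=> /csmooth_onP sf /csmooth_onP sg; apply/csmooth_onP => k.
exact: smooth_orderM.
Qed.

Lemma csmooth_onV f : (forall x, U x -> f x != 0) -> csmooth_on U f ->
  csmooth_on U (fun x => (f x)^-1).
Proof.
by move=> f0 /csmooth_onP sf; apply/csmooth_onP => k; exact: smooth_orderV.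
Qed.

Lemma csmooth_onN f : csmooth_on U f -> csmooth_on U (fun x => - f x).
Proof.
move=> sf; apply: (@csmooth_on_eq (fun x => -1 * f x)).
  by move=> x _; rewrite mulN1r.
by apply: csmooth_onM => //; exact: csmooth_on_cst.
Qed.

Lemma csmooth_onB f g : csmooth_on U f -> csmooth_on U g ->
  csmooth_on U (fun x => f x - g x).
Proof. by move=> sf sg; apply: csmooth_onD => //; exact: csmooth_onN. Qed.

Lemma csmooth_on_sum (I : Type) (r : seq I) (P : pred I) (F : I -> V -> C) :
  (forall i, csmooth_on U (F i)) ->
  csmooth_on U (fun x => \sum_(i <- r | P i) F i x).
Proof.
move=> sF; apply/csmooth_onP => k; apply: smooth_order_sum => i.
by have /csmooth_onP := sF i.
Qed.

Lemma csmooth_on_prod (I : Type) (r : seq I) (P : pred I) (F : I -> V -> C) :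
  (forall i, csmooth_on U (F i)) ->
  csmooth_on U (fun x => \prod_(i <- r | P i) F i x).
Proof.
move=> sF; elim: r => [|i r IH].
  by under eq_fun do rewrite big_nil; exact: csmooth_on_cst.
under eq_fun do rewrite big_cons; case: (P i) => //.
exact: csmooth_onM.
Qed.

End OpenDomain.
Lemma cpartial_swap f x i j U : open U -> csmooth_on U f -> U x ->
  cpartial i (cpartial j f) x = cpartial j (cpartial i f) x.
Proof.
move=> oU sf Ux; have nU : nbhs x U by exact: open_nbhs_nbhs.
have [d1 d2] := csmooth_on_cdiff (csmooth_on_cpartial i sf) Ux.
have [d3 d4] := csmooth_on_cdiff (csmooth_on_cpartial j sf) Ux.
apply: complex_eq => /=; apply: derive_swap => //; apply: filterS nU => y Uy.
  by case: (csmooth_on_cdiff sf Uy).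
by case: (csmooth_on_cdiff sf Uy).
Qed.

End ComplexCalculus.

(** * Chain rule *)

Section ChainRule.
Context {R : realType} {n : nat}.
Local Notation C := R[i].
Local Notation V := 'rV[R]_n.
Implicit Types (f : V -> C) (x : V) (U W : set V) (j k : 'I_n) (F : V -> V).

Lemma rV_differentiable F x :
  (forall k, differentiable (fun y => F y 0 k) x) -> differentiable F x.
Proof.
move=> dF.
have -> : F = \sum_(k < n) (fun y => F y 0 k *: delta_mx 0 k : V).
  by apply/funext => y; rewrite fct_sumE -row_sum_delta.
by apply: differentiable_sum => k; exact: differentiableZl.
Qed.

Lemma jacobianE F x j k : differentiable F x ->
  'J F x j k = partial j (fun y => F y 0 k) x.
Proof.
move=> dF; rewrite /jacobian mxE -deriveE// derive_mx ?mxE//.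
exact: diff_derivable.
Qed.

Lemma partial_comp (g : V -> R) F x j :
  differentiable F x -> differentiable g (F x) ->
  partial j (fun y => g (F y)) x =
  \sum_k partial j (fun y => F y 0 k) x * partial k g (F x).
Proof.
move=> dF dg; rewrite /partial (deriveE _ (differentiable_comp dF dg)) diff_comp//=.
rewrite [X in 'd g _ X]row_sum_delta linear_sum; apply: eq_bigr => k _.
rewrite linearZ /= (deriveE _ dg); congr (_ *: _).
by have := jacobianE j k dF; rewrite /partial /jacobian mxE.
Qed.

Lemma cdiff_comp f F x : differentiable F x -> cdiff f (F x) ->
  cdiff (fun y => f (F y)) x.
Proof.
by move=> dF [f1 f2]; split;
  [exact: (differentiable_comp dF f1)|exact: (differentiable_comp dF f2)].
Qed.

Lemma cpartial_comp f F x j : differentiable F x -> cdiff f (F x) ->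
  cpartial j (fun y => f (F y)) x =
  \sum_k cpartial j (fun y => (F y 0 k)%:C%C) x * cpartial k f (F x).
Proof.
move=> dF [f1 f2].
apply: complex_eq.
  rewrite (big_morph _ complex_ReD (id1 := 0))// [LHS](partial_comp _ dF f1).
  by apply: eq_bigr => k _; rewrite cpartial_real complex_ReM /= mul0r subr0.
rewrite (big_morph _ complex_ImD (id1 := 0))// [LHS](partial_comp _ dF f2).
by apply: eq_bigr => k _; rewrite cpartial_real complex_ImM /= mul0r addr0.
Qed.

Definition smooth_map U F := forall k, csmooth_on U (fun y => (F y 0 k)%:C%C).

Lemma smooth_map_diff U F x : smooth_map U F -> U x -> differentiable F x.
Proof.
move=> sF Ux; apply: rV_differentiable => k.
by have [] := csmooth_on_cdiff (sF k) Ux.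
Qed.

Lemma csmooth_on_comp U W F f : open U -> smooth_map U F ->
  (forall x, U x -> W (F x)) -> csmooth_on W f ->
  csmooth_on U (fun x => f (F x)).
Proof.
move=> oU sF FUW /csmooth_onP sf; apply/csmooth_onP => m.
have {sf} := sf m; elim: m f => [|m IH] f [df pf].
  by split=> // x Ux; apply: cdiff_comp; [exact: smooth_map_diff sF Ux|auto].
split=> [x Ux|j].
  by apply: cdiff_comp; [exact: smooth_map_diff sF Ux|auto].
apply: (@smooth_order_eq _ _ _ oU _
   (fun x => \sum_k cpartial j (fun y => (F y 0 k)%:C%C) x * cpartial k f (F x))).
  move=> x Ux; rewrite [RHS]cpartial_comp//; [exact: smooth_map_diff sF Ux|auto].
apply: smooth_order_sum => // k; apply: smooth_orderM => //; last exact/IH/pf.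
have /csmooth_onP := csmooth_on_cpartial j (sF k); exact.
Qed.

End ChainRule.

(** * Involutivity at a point *)

Section Involutivity.
Context {R : realType} {n : nat}.
Local Notation C := R[i].
Local Notation V := 'rV[R]_n.
Local Notation form := (mixed_form R n).
Local Notation iota := interior_product.
Implicit Types (x : V) (j k : 'I_n) (phi : V -> form) (s t : V -> gvec R n).

(** Minus twice [gmetric], which spares the constant in the Clifford relation. *)
Definition gdot (u w : gvec R n) : C := contract u.1 w.2 + contract w.1 u.2.

Definition gcdiff s x :=
  forall k, cdiff (fun y => (s y).1 0 k) x /\ cdiff (fun y => (s y).2 0 k) x.

Definition rpartial j (X : V -> 'rV[C]_n) x : 'rV[C]_n :=
  \row_k cpartial j (fun y => X y 0 k) x.

Definition gpartial j s x : gvec R n :=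
  (rpartial j (fun y => (s y).1) x, rpartial j (fun y => (s y).2) x).

Definition fpartial j phi x : form := fun L => cpartial j (fun y => phi y L) x.

Lemma is_form_fpartial j phi x : (forall y, is_form (phi y)) ->
  (forall L, cdiff (fun y => phi y L) x) -> is_form (fpartial j phi x).
Proof.
move=> fphi dphi; split=> [s1 s2 a u v|s1 s2 s3 u]; rewrite /fpartial.
  under eq_fun do rewrite (fphi _).1.
  by rewrite cpartialD ?cpartialZ//; exact: cdiffZ.
by under eq_fun do rewrite (fphi _).2; exact: cpartial_cst.
Qed.

Lemma cdiff_contract (X eta : V -> 'rV[C]_n) x :
  (forall k, cdiff (fun y => X y 0 k) x) ->
  (forall k, cdiff (fun y => eta y 0 k) x) ->
  cdiff (fun y => contract (X y) (eta y)) x.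
Proof. by move=> dX de; apply: cdiff_sum => k; exact: cdiffM. Qed.

Lemma cpartial_contract (X eta : V -> 'rV[C]_n) x j :
  (forall k, cdiff (fun y => X y 0 k) x) ->
  (forall k, cdiff (fun y => eta y 0 k) x) ->
  cpartial j (fun y => contract (X y) (eta y)) x =
  contract (rpartial j X x) (eta x) + contract (X x) (rpartial j eta x).
Proof.
move=> dX de; rewrite cpartial_sum; last by move=> k; exact: cdiffM.
rewrite /contract -big_split; apply: eq_bigr => k _ /=.
by rewrite cpartialM// !mxE; ring.
Qed.

Lemma cdiff_ext (xi : V -> 'rV[C]_n) phi x L :
  (forall k, cdiff (fun y => xi y 0 k) x) ->
  (forall L, cdiff (fun y => phi y L) x) ->
  cdiff (fun y => ext (xi y) (phi y) L) x.
Proof.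
move=> dx; elim: L phi => [|v L IH] phi dphi.
  by under eq_fun do rewrite ext_nil; exact: cdiff_cst.
under eq_fun do rewrite ext_cons; apply: cdiffB.
  by apply: cdiffM => //; apply: cdiff_contract => // k; exact: cdiff_cst.
by apply: (IH (fun y => iota v (phi y))) => L'; exact: dphi.
Qed.

Lemma cpartial_ext (xi : V -> 'rV[C]_n) phi x j L :
  (forall k, cdiff (fun y => xi y 0 k) x) ->
  (forall L, cdiff (fun y => phi y L) x) ->
  cpartial j (fun y => ext (xi y) (phi y) L) x =
  ext (rpartial j xi x) (phi x) L + ext (xi x) (fpartial j phi x) L.
Proof.
move=> dx; elim: L phi => [|v L IH] phi dphi.
  by under eq_fun do rewrite ext_nil; rewrite cpartial_cst !ext_nil addr0.
have dc : cdiff (fun y => contract v (xi y)) x.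
  by apply: cdiff_contract => // k; exact: cdiff_cst.
have dcst k : cdiff (fun=> v 0 k) x by exact: cdiff_cst.
have di L' : cdiff (fun y => iota v (phi y) L') x by exact: dphi.
under eq_fun do rewrite ext_cons; rewrite cpartialB; last 2 first.
- exact: cdiffM.
- exact: (@cdiff_ext xi (fun y => iota v (phi y))).
rewrite (IH (fun y => iota v (phi y)))// cpartialM//.
rewrite (@cpartial_contract (fun=> v))// !ext_cons.
have -> : rpartial j (fun=> v) x = 0.
  by apply/rowP => k; rewrite !mxE cpartial_cst.
by rewrite contract0l /fpartial /iota; ring.
Qed.

Lemma form_row_sum (psi : form) v L : is_form psi ->
  psi (v :: L) = \sum_k v 0 k * psi (delta_mx 0 k :: L).
Proof.
move=> fpsi; rewrite {1}(row_sum_delta v) (form_sum [::])//.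
by apply: eq_bigr => k _; rewrite (formZ [::]).
Qed.

Lemma cpartial_cl s phi x j L : gcdiff s x -> (forall y, is_form (phi y)) ->
  (forall L, cdiff (fun y => phi y L) x) ->
  cpartial j (fun y => cl (s y) (phi y) L) x =
  cl (gpartial j s x) (phi x) L + cl (s x) (fpartial j phi x) L.
Proof.
move=> ds fphi dphi.
have ds1 k : cdiff (fun y => (s y).1 0 k) x by case: (ds k).
have ds2 k : cdiff (fun y => (s y).2 0 k) x by case: (ds k).
have dM k : cdiff (fun y => (s y).1 0 k * phi y (delta_mx 0 k :: L)) x.
  exact: cdiffM.
rewrite cpartialD; last 2 first.
- rewrite /iota; under eq_fun do rewrite form_row_sum//.
  exact: cdiff_sum.
- exact: cdiff_ext.
rewrite cpartial_ext// /cl /iota; under eq_fun do rewrite form_row_sum//.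
rewrite cpartial_sum// (form_row_sum (gpartial j s x).1)//.
rewrite (form_row_sum (s x).1); last exact: is_form_fpartial.
rewrite addrACA; congr (_ + _); rewrite -big_split; apply: eq_bigr => k _ /=.
by rewrite cpartialM// mxE.
Qed.

Lemma ext_sum_delete xi (psi : form) L : ext xi psi L =
  \sum_(i < size L) (-1) ^+ i * contract (nth 0 L i) xi * psi (delete_nth i L).
Proof.
elim: L psi => [|v L IH] psi; first by rewrite big_ord0.
rewrite ext_cons big_ord_recl /= expr0 mul1r {1}/delete_nth take0 drop1 /=.
congr (_ + _); rewrite IH -sumrN; apply: eq_bigr => i _.
by rewrite /bump /= add1n exprS mulN1r !mulNr.
Qed.

Lemma contract_delta v j : contract v (delta_mx 0 j) = v 0 j :> C.
Proof.
rewrite /contract (bigD1 j)//= big1 ?addr0 ?mxE ?eqxx ?mul1r// => k kj.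
by rewrite !mxE (negbTE kj) mul0r.
Qed.

Lemma dformE phi x L :
  dform phi x L = \sum_j ext (delta_mx 0 j) (fpartial j phi x) L.
Proof.
under [RHS]eq_bigr do rewrite ext_sum_delete.
rewrite exchange_big; apply: eq_bigr => i _ /=.
rewrite /cderive mulr_sumr; apply: eq_bigr => j _.
by rewrite contract_delta mulrA.
Qed.

Lemma cl_sum (u : gvec R n) (c : 'I_n -> C) (psi : 'I_n -> form) L :
  cl u (fun L => \sum_j c j * psi j L) L = \sum_j c j * cl u (psi j) L.
Proof.
suff H (r : seq 'I_n) : cl u (fun L => \sum_(j <- r) c j * psi j L) =
    fun L => \sum_(j <- r) c j * cl u (psi j) L by rewrite H.
elim: r => [|j r IH].
  under eq_fun do rewrite big_nil; apply/funext => L'; rewrite big_nil.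
  by rewrite /cl ext0 addr0.
have -> : (fun L => \sum_(j <- (j :: r)) c j * psi j L) =
    lincomb (c j) (psi j) (fun L => \sum_(j <- r) c j * psi j L).
  by apply/funext => L'; rewrite big_cons.
by rewrite cl_lincomb IH; apply/funext => L'; rewrite big_cons.
Qed.

Lemma cl0 (u : gvec R n) : cl u (fun=> 0) = fun=> 0.
Proof. by apply/funext => L; rewrite /cl ext0 addr0. Qed.

Lemma cl_scale (u : gvec R n) a (psi : form) L :
  cl u (fun M => a * psi M) L = a * cl u psi L.
Proof. by rewrite /cl extZ mulrDr. Qed.

Lemma cl_suml (I : Type) (r : seq I) (w : I -> gvec R n) (psi : form) L :
  is_form psi -> cl (\sum_(i <- r) w i) psi L = \sum_(i <- r) cl (w i) psi L.
Proof.
move=> fpsi; elim: r => [|i r IH].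
  rewrite !big_nil /cl /iota (form0 [::])// add0r.
  have := congr1 (@^~ L) (ext_lincombl (-1) 0 0 psi).
  by rewrite scaler0 addr0 /lincomb mulN1r addNr.
rewrite !big_cons -IH -[w i]scale1r cl_lincombl// /lincomb mul1r.
by rewrite scale1r.
Qed.

Lemma clD (u w : gvec R n) (psi : form) L :
  is_form psi -> cl (u + w) psi L = cl u psi L + cl w psi L.
Proof. by move=> fpsi; rewrite -[u]scale1r cl_lincombl// /lincomb mul1r scale1r. Qed.

Lemma clZ (a : C) (u : gvec R n) (psi : form) L :
  is_form psi -> cl (a *: u) psi L = a * cl u psi L.
Proof.
move=> fpsi; rewrite -[a *: u]addr0 cl_lincombl// /lincomb.
have := @cl_suml 'I_n [::] (fun=> 0) psi L fpsi.
by rewrite !big_nil => ->; rewrite addr0.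
Qed.

Let e_ j : gvec R n := (0, delta_mx 0 j).

Lemma cl_e j (psi : form) : is_form psi -> cl (e_ j) psi = ext (delta_mx 0 j) psi.
Proof.
by move=> fpsi; apply/funext => L; rewrite /cl /iota (form0 [::])// add0r.
Qed.

Lemma gdot_e j (u : gvec R n) : gdot (e_ j) u = u.1 0 j.
Proof. by rewrite /gdot /= contract0l add0r contract_delta. Qed.

Lemma gdotC (u w : gvec R n) : gdot u w = gdot w u.
Proof. by rewrite /gdot addrC. Qed.

(** The bracket X^j d_j t - Y^j d_j s - gdot s (d_j t) dx^j, which is not skew but
    involves only derivatives of whole sections. *)
Definition dcourant s t x : gvec R n :=
  \sum_j ((s x).1 0 j *: gpartial j t x + (- (t x).1 0 j) *: gpartial j s x
          + (- gdot (s x) (gpartial j t x)) *: e_ j).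

(** The k-th covector component of the Courant bracket is
    X^j d_j eta_k - Y^j d_j xi_k plus one half of gdot (d_k s) t - gdot s (d_k t),
    and isotropy gives gdot (d_k s) t = - gdot s (d_k t). *)
Lemma courant_dcourant s t x : gcdiff s x -> gcdiff t x ->
  (\forall y \near x, gdot (s y) (t y) = 0) ->
  courant_coord s t x = dcourant s t x.
Proof.
move=> ds dt st0.
have ds1 k : cdiff (fun y => (s y).1 0 k) x by case: (ds k).
have ds2 k : cdiff (fun y => (s y).2 0 k) x by case: (ds k).
have dt1 k : cdiff (fun y => (t y).1 0 k) x by case: (dt k).
have dt2 k : cdiff (fun y => (t y).2 0 k) x by case: (dt k).
have iso k : gdot (gpartial k s x) (t x) + gdot (s x) (gpartial k t x) = 0.
  rewrite -(cpartial_cst 0 x k) -(near_eq_cpartial k st0) /gdot.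
  rewrite cpartialD; [|exact: cdiff_contract..].
  by rewrite !cpartial_contract//=; ring.
have sum1 (I : Type) (r : seq I) (w : I -> gvec R n) :
    (\sum_(i <- r) w i).1 = \sum_(i <- r) (w i).1.
  by elim: r => [|i r IH]; rewrite ?big_nil ?big_cons//= IH.
have sum2 (I : Type) (r : seq I) (w : I -> gvec R n) :
    (\sum_(i <- r) w i).2 = \sum_(i <- r) (w i).2.
  by elim: r => [|i r IH]; rewrite ?big_nil ?big_cons//= IH.
rewrite [RHS]surjective_pairing sum1 sum2; congr (_, _); apply/rowP => k.
  rewrite !mxE summxE /cderive -sumrB; apply: eq_bigr => j _.
  by rewrite !mxE; ring.
rewrite !mxE summxE /cderive.
rewrite cpartialB; [|exact: cdiff_contract..].
rewrite !cpartial_contract//.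
have -> : \sum_(i < n) ((s x).1 0 i *: gpartial i t x +
     - (t x).1 0 i *: gpartial i s x +
     - gdot (s x) (gpartial i t x) *: e_ i).2 0 k =
   \sum_(j < n) (s x).1 0 j * cpartial j (fun y => (t y).2 0 k) x -
   \sum_(j < n) (t x).1 0 j * cpartial j (fun y => (s y).2 0 k) x -
   gdot (s x) (gpartial k t x).
  rewrite -!sumrB [X in _ = _ - X](_ : _ =
    \sum_j gdot (s x) (gpartial j t x) * (delta_mx 0 j : 'rV[C]_n) 0 k).
    by rewrite -sumrB; apply: eq_bigr => j _; rewrite !mxE; ring.
  rewrite (bigD1 k)//= big1 ?addr0 ?mxE ?eqxx ?mulr1// => j jk.
  by rewrite mxE eq_sym (negbTE jk) andbF mulr0.
have S1 : \sum_l (t x).2 0 l * cpartial k (fun y => (s y).1 0 l) x =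
    contract (rpartial k (fun y => (s y).1) x) (t x).2.
  by apply: eq_bigr => l _; rewrite mxE.
have S2 : \sum_l (s x).2 0 l * cpartial k (fun y => (t y).1 0 l) x =
    contract (rpartial k (fun y => (t y).1) x) (s x).2.
  by apply: eq_bigr => l _; rewrite mxE.
rewrite S1 S2; have := iso k; rewrite /gdot /= => /eqP; rewrite addr_eq0 => /eqP E.
set a := \sum_(j < n) _; set b := \sum_(j < n) _.
move: E; set A := contract _ _; set D := contract _ _.
set C' := contract _ _; set B := contract _ _ => E.
have -> : A = - (C' + B) - D by rewrite -E; ring.
by field.
Qed.

(** Write P_j = d_j phi. Differentiating t . phi = 0, applying dx^j and summing
    gives Y^j P_j = - dx^j . (d_j t . phi), because dx^j . P_j sums to d phi = 0.
    Applying s and using s . P_j = - d_j s . phi and s . phi = 0 moves s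
    through dx^j and d_j t, with contractions X^j and gdot s (d_j t). *)
Theorem courant_annihilates s t phi x :
  gcdiff s x -> gcdiff t x -> (forall y, is_form (phi y)) ->
  (forall L, cdiff (fun y => phi y L) x) ->
  (\forall y \near x, cl (s y) (phi y) = fun=> 0) ->
  (\forall y \near x, cl (t y) (phi y) = fun=> 0) ->
  (\forall y \near x, gdot (s y) (t y) = 0) ->
  dform phi x = (fun=> 0) ->
  cl (courant_coord s t x) (phi x) = fun=> 0.
Proof.
move=> ds dt fphi dphi sphi tphi st0 dphi0.
rewrite courant_dcourant//; apply/funext => L.
pose P j := fpartial j phi x.
have fP j : is_form (P j) by exact: is_form_fpartial.
have leib (w : V -> gvec R n) j : gcdiff w x ->
    (\forall y \near x, cl (w y) (phi y) = fun=> 0) ->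
    cl (w x) (P j) = fun M => -1 * cl (gpartial j w x) (phi x) M.
  move=> dw w0; apply/funext => M; apply/eqP; rewrite -subr_eq0 mulN1r opprK addrC.
  rewrite -cpartial_cl//; apply/eqP; rewrite -(cpartial_cst 0 x j).
  by apply: near_eq_cpartial; apply: filterS w0 => y ->.
have sx0 : cl (s x) (phi x) = fun=> 0 by exact: nbhs_singleton sphi.
pose Q j := cl (gpartial j t x) (phi x).
have fQ j : is_form (Q j) by exact: is_form_cl.
have fphix := fphi x.
have YP M : \sum_j (t x).1 0 j * P j M = - \sum_j cl (e_ j) (Q j) M.
  transitivity (\sum_j (- cl (e_ j) (Q j) M + cl (t x) (cl (e_ j) (P j)) M)).
    apply: eq_bigr => j _; rewrite -gdot_e -[LHS]cl_anticommute// leib//.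
    by rewrite cl_scale mulN1r.
  rewrite big_split /= sumrN.
  have -> : \sum_j cl (t x) (cl (e_ j) (P j)) M =
      cl (t x) (fun M => \sum_j 1 * cl (e_ j) (P j) M) M.
    by rewrite cl_sum; apply: eq_bigr => j _; rewrite mul1r.
  rewrite (_ : (fun M => _) = fun=> 0) ?cl0 ?addr0//.
  rewrite -dphi0; apply/funext => M'; rewrite dformE.
  by apply: eq_bigr => j _; rewrite mul1r cl_e.
have main : \sum_j (t x).1 0 j * cl (gpartial j s x) (phi x) L =
    \sum_j ((s x).1 0 j * Q j L -
       gdot (s x) (gpartial j t x) * cl (e_ j) (phi x) L).
  have : cl (s x) (fun M => \sum_j (t x).1 0 j * P j M) L =
         cl (s x) (fun M => \sum_j -1 * cl (e_ j) (Q j) M) L.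
    congr (cl _ _ _); apply/funext => M; rewrite YP -sumrN.
    by apply: eq_bigr => j _; rewrite mulN1r.
  rewrite !cl_sum => /(congr1 -%R); rewrite -!sumrN => E.
  transitivity (\sum_j - ((t x).1 0 j * cl (s x) (P j) L)).
    by apply: eq_bigr => j _; rewrite leib//; ring.
  rewrite E; apply: eq_bigr => j _.
  have := @cl_anticommute R n (s x) (e_ j) (Q j) L (fQ j).
  rewrite -/(gdot (s x) (e_ j)) gdotC gdot_e.
  rewrite (_ : cl (s x) (Q j) =
    fun M => gdot (s x) (gpartial j t x) * phi x M).
    by rewrite cl_scale => <-; ring.
  apply/funext => M; rewrite /gdot -cl_anticommute// sx0 /Q.
  by rewrite cl0 addr0.
rewrite /dcourant cl_suml//.
transitivity (\sum_j ((s x).1 0 j * Q j L -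
       gdot (s x) (gpartial j t x) * cl (e_ j) (phi x) L -
    (t x).1 0 j * cl (gpartial j s x) (phi x) L)).
  by apply: eq_bigr => j _; rewrite /Q !clD// !clZ//; ring.
by rewrite sumrB -main subrr.
Qed.
End Involutivity.

(** * Naturality of the Courant bracket *)

Section CourantNaturality.
Context {R : realType} {n : nat}.
Local Notation C := R[i].
Local Notation V := 'rV[R]_n.
Implicit Types (x y : V) (i j k l : 'I_n) (s t : V -> gvec R n).

(** The entry d_i F_k of the Jacobian, as a complex-valued function so that the
    same calculus applies to it. *)
Definition cjac (F : V -> V) i k : V -> C :=
  cpartial i (fun y => (F y 0 k)%:C%C).

(** The two sides are the components of one generalized vector in two charts that
    differ by F: vectors are pushed forward and covectors pulled back, so that no
    inverse of the Jacobian is needed. *)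
Definition related (F : V -> V) y (u w : gvec R n) :=
  (forall k, w.1 0 k = \sum_i u.1 0 i * cjac F i k y) /\
  (forall i, u.2 0 i = \sum_k w.2 0 k * cjac F i k y).

Lemma related_contract (F : V -> V) y (u u' w w' : gvec R n) :
  related F y u w -> related F y u' w' ->
  contract u.1 u'.2 = contract w.1 w'.2.
Proof.
move=> [H1 _] [_ H2]; rewrite /contract.
under eq_bigr do rewrite H2 mulr_suml.
under [RHS]eq_bigr do rewrite H1 mulr_sumr.
by rewrite exchange_big; apply: eq_bigr => k _; apply: eq_bigr => i _ /=; ring.
Qed.

Lemma sum_leibniz (X Y a : 'I_n -> C) (D h : 'I_n -> 'I_n -> C) :
  \sum_j X j * (\sum_i (D j i * a i + Y i * h j i)) =
  \sum_i (\sum_j X j * D j i) * a i + \sum_j \sum_i X j * Y i * h j i.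
Proof.
under [X in _ = X + _]eq_bigr do rewrite mulr_suml.
rewrite [X in _ = X + _]exchange_big -big_split; apply: eq_bigr => j _ /=.
by rewrite mulr_sumr -big_split; apply: eq_bigr => i _ /=; ring.
Qed.

Section Bracket.
Variables (U W : set V) (F : V -> V).
Hypotheses (oU : open U) (sF : smooth_map U F) (FUW : forall x, U x -> W (F x)).

Lemma related_cderive x (u w : gvec R n) f : U x -> related F x u w ->
  cdiff f (F x) ->
  cderive w.1 f (F x) = cderive u.1 (fun y => f (F y)) x.
Proof.
move=> Ux [H1 _] df; have dF := smooth_map_diff sF Ux.
rewrite /cderive; under eq_bigr do rewrite H1 mulr_suml.
rewrite exchange_big; apply: eq_bigr => j _ /=.
by rewrite cpartial_comp// mulr_sumr; apply: eq_bigr => k _; rewrite mulrA.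
Qed.

Definition hess i j k x := cpartial i (cjac F j k) x.

Lemma hess_sym i j k x : U x -> hess i j k x = hess j i k x.
Proof. exact: (cpartial_swap _ _ oU). Qed.

Lemma cdiff_cjac i k x : U x -> cdiff (cjac F i k) x.
Proof. exact/csmooth_on_cdiff/csmooth_on_cpartial. Qed.

Variables (s t s' t' : V -> gvec R n).
Hypothesis ss : forall x, U x -> gcdiff s x.
Hypothesis st : forall x, U x -> gcdiff t x.
Hypothesis ss' : forall x, W x -> gcdiff s' x.
Hypothesis st' : forall x, W x -> gcdiff t' x.
Hypothesis rs : forall x, U x -> related F x (s x) (s' (F x)).
Hypothesis rt : forall x, U x -> related F x (t x) (t' (F x)).

Lemma cpartial_related_vector (w w' : V -> gvec R n) x j k : U x ->
  (forall x, U x -> gcdiff w x) ->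
  (forall x, U x -> related F x (w x) (w' (F x))) ->
  cpartial j (fun y => (w' (F y)).1 0 k) x =
  \sum_i (cpartial j (fun y => (w y).1 0 i) x * cjac F i k x +
          (w x).1 0 i * hess j i k x).
Proof.
move=> Ux dw rw.
rewrite (@near_eq_cpartial _ _ _ (fun y => \sum_i (w y).1 0 i * cjac F i k y)).
  have dwx i : cdiff (fun y => (w y).1 0 i) x by case: (dw x Ux i).
  have dJ i := cdiff_cjac i k Ux.
  rewrite cpartial_sum => [|i]; last exact: cdiffM.
  by apply: eq_bigr => i _; rewrite cpartialM.
by apply: open_near_eq Ux => // y Uy; exact: (rw y Uy).1.
Qed.

Lemma cpartial_related_covector (w w' : V -> gvec R n) x j i : U x ->
  (forall x, W x -> gcdiff w' x) ->
  (forall x, U x -> related F x (w x) (w' (F x))) ->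
  cpartial j (fun y => (w y).2 0 i) x =
  \sum_k (cpartial j (fun y => (w' (F y)).2 0 k) x * cjac F i k x +
          (w' (F x)).2 0 k * hess j i k x).
Proof.
move=> Ux dw rw.
rewrite (@near_eq_cpartial _ _ _ (fun y => \sum_k (w' (F y)).2 0 k * cjac F i k y)).
  have dwx k : cdiff (fun y => (w' (F y)).2 0 k) x.
    apply: (@cdiff_comp _ _ (fun z => (w' z).2 0 k)).
      exact: smooth_map_diff sF Ux.
    by case: (dw (F x) (FUW Ux) k).
  have dJ k := cdiff_cjac i k Ux.
  rewrite cpartial_sum => [|k]; last exact: cdiffM.
  by apply: eq_bigr => k _; rewrite cpartialM.
by apply: open_near_eq Ux => // y Uy; exact: (rw y Uy).2.
Qed.

(** Second derivatives of F enter symmetrically and cancel. *)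
Lemma related_lie_bracket x k : U x ->
  lie_bracket (fun y => (s' y).1) (fun y => (t' y).1) (F x) 0 k =
  \sum_i lie_bracket (fun y => (s y).1) (fun y => (t y).1) x 0 i * cjac F i k x.
Proof.
move=> Ux; rewrite mxE.
have Wx := FUW Ux.
rewrite (related_cderive Ux (rs Ux)); last by case: (st' Wx k).
rewrite (related_cderive Ux (rt Ux)); last by case: (ss' Wx k).
rewrite /cderive.
under eq_bigr do rewrite (cpartial_related_vector _ _ Ux st rt).
under [X in _ - X]eq_bigr do rewrite (cpartial_related_vector _ _ Ux ss rs).
rewrite !sum_leibniz.
have -> : \sum_j \sum_i (t x).1 0 j * (s x).1 0 i * hess j i k x =
    \sum_j \sum_i (s x).1 0 j * (t x).1 0 i * hess j i k x.
  rewrite exchange_big; apply: eq_bigr => j _; apply: eq_bigr => i _ /=.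
  by rewrite (hess_sym i j _ Ux) (mulrC ((t x).1 0 i)).
rewrite opprD addrACA subrr addr0 -sumrB.
by apply: eq_bigr => i _; rewrite mxE /cderive mulrBl.
Qed.

(** The second derivatives of F that come from eta and from X agree by symmetry. *)
Lemma related_lie_derive x i : U x ->
  lie_derive (fun y => (s y).1) (fun y => (t y).2) x 0 i =
  \sum_k lie_derive (fun y => (s' y).1) (fun y => (t' y).2) (F x) 0 k * cjac F i k x.
Proof.
move=> Ux; have Wx := FUW Ux; have dF := smooth_map_diff sF Ux.
rewrite mxE /cderive.
under eq_bigr do rewrite (cpartial_related_covector _ _ Ux st' rt).
rewrite sum_leibniz.
under [RHS]eq_bigr do rewrite mxE mulrDl.
rewrite [RHS]big_split /= -addrA; congr (_ + _).
  apply: eq_bigr => k _; rewrite (related_cderive Ux (rs Ux))//.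
  by case: (st' Wx k).
transitivity (\sum_l (t' (F x)).2 0 l * cpartial i (fun y => (s' (F y)).1 0 l) x).
  under [RHS]eq_bigr do
    rewrite (cpartial_related_vector _ _ Ux ss rs) big_split mulrDr /=.
  rewrite [RHS]big_split /= addrC; congr (_ + _).
    under eq_bigr do rewrite (rt Ux).2 mulr_suml.
    rewrite exchange_big; apply: eq_bigr => l _ /=.
    by rewrite mulr_sumr; apply: eq_bigr => m _; ring.
  rewrite exchange_big; apply: eq_bigr => l _ /=.
  rewrite mulr_sumr; apply: eq_bigr => m _.
  by rewrite (hess_sym m i _ Ux); ring.
under [RHS]eq_bigr do rewrite mulr_suml.
rewrite [RHS]exchange_big; apply: eq_bigr => l _ /=.
rewrite (@cpartial_comp _ _ (fun z => (s' z).1 0 l))//; last by case: (ss' Wx l).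
by rewrite mulr_sumr; apply: eq_bigr => k _; rewrite /cjac; ring.
Qed.

Lemma related_differential (f f' : V -> C) x i : U x ->
  (forall y, U y -> f y = f' (F y)) -> cdiff f' (F x) ->
  differential f x 0 i = \sum_k differential f' (F x) 0 k * cjac F i k x.
Proof.
move=> Ux ff df; rewrite mxE (@near_eq_cpartial _ _ _ (fun y => f' (F y))).
  rewrite cpartial_comp//; last exact: smooth_map_diff sF Ux.
  by apply: eq_bigr => k _; rewrite mxE mulrC.
exact: open_near_eq Ux.
Qed.

End Bracket.

Theorem related_courant (U W : set V) (F : V -> V) (s t s' t' : V -> gvec R n) :
  open U -> smooth_map U F -> (forall x, U x -> W (F x)) ->
  (forall x, U x -> gcdiff s x) -> (forall x, U x -> gcdiff t x) ->
  (forall x, W x -> gcdiff s' x) -> (forall x, W x -> gcdiff t' x) ->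
  (forall x, U x -> related F x (s x) (s' (F x))) ->
  (forall x, U x -> related F x (t x) (t' (F x))) ->
  forall x, U x -> related F x (courant_coord s t x) (courant_coord s' t' (F x)).
Proof.
move=> oU sF FUW ds dt ds' dt' rs rt x Ux; split=> [k|i].
  exact: (related_lie_bracket oU sF FUW ds dt ds' dt' rs rt).
have ds1 k : cdiff (fun y => (s' y).1 0 k) (F x) by case: (ds' _ (FUW _ Ux) k).
have ds2 k : cdiff (fun y => (s' y).2 0 k) (F x) by case: (ds' _ (FUW _ Ux) k).
have dt1 k : cdiff (fun y => (t' y).1 0 k) (F x) by case: (dt' _ (FUW _ Ux) k).
have dt2 k : cdiff (fun y => (t' y).2 0 k) (F x) by case: (dt' _ (FUW _ Ux) k).
rewrite [LHS]/= [RHS](_ : _ = \sum_k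
   (lie_derive (fun y => (s' y).1) (fun y => (t' y).2) (F x) 0 k * cjac F i k x -
    lie_derive (fun y => (t' y).1) (fun y => (s' y).2) (F x) 0 k * cjac F i k x -
    2^-1 * (differential (fun y => contract (s' y).1 (t' y).2
       - contract (t' y).1 (s' y).2) (F x) 0 k * cjac F i k x))); last first.
  by apply: eq_bigr => k _; rewrite !mxE; ring.
rewrite !sumrB -mulr_sumr.
rewrite -(related_lie_derive oU sF FUW ds ds' dt' rs rt)//.
rewrite -(related_lie_derive oU sF FUW dt dt' ds' rt rs)//.
rewrite -(related_differential oU sF (f := fun y => contract (s y).1 (t y).2
       - contract (t y).1 (s y).2))//.
- by rewrite !mxE.
- move=> y Uy; rewrite (related_contract (rs y Uy) (rt y Uy)).
  by rewrite (related_contract (rt y Uy) (rs y Uy)).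
- by apply: cdiffB; exact: cdiff_contract.
Qed.
End CourantNaturality.

(** * Smooth frames of annihilators *)

Section Frames.
Context {R : realType} {n : nat}.
Local Notation C := R[i].
Local Notation V := 'rV[R]_n.
Local Notation form := (mixed_form R n).
Implicit Types (x : V) (L : seq 'rV[C]_n).

Lemma csmooth_on_det (U : set V) m (A : V -> 'M[C]_m) : open U ->
  (forall i j, csmooth_on U (fun x => A x i j)) ->
  csmooth_on U (fun x => \det (A x)).
Proof.
move=> oU sA; apply: csmooth_on_sum => // p; apply: csmooth_onM => //.
  exact: csmooth_on_cst.
exact: csmooth_on_prod.
Qed.

Lemma csmooth_on_invmx (U : set V) m (A : V -> 'M[C]_m) i j : open U ->
  (forall i j, csmooth_on U (fun x => A x i j)) ->
  (forall x, U x -> \det (A x) != 0) ->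
  csmooth_on U (fun x => invmx (A x) i j).
Proof.
move=> oU sA dA.
apply: (@csmooth_on_eq _ _ _ oU (fun x => (\det (A x))^-1 *
  ((-1) ^+ (j + i) * \det (row' j (col' i (A x)))))).
  by move=> x /dA dx; rewrite /invmx unitmxE unitfE dx !mxE.
apply: csmooth_onM => //; first by apply: csmooth_onV => //; exact: csmooth_on_det.
apply: csmooth_onM => //; first exact: csmooth_on_cst.
by apply: csmooth_on_det => // k l; under eq_fun do rewrite !mxE; exact: sA.
Qed.

Definition gvec_of_row (w : 'rV[C]_(n + n)) : gvec R n := (lsubmx w, rsubmx w).

Lemma gvec_of_rowK (u : gvec R n) : gvec_of_row (row_mx u.1 u.2) = u.
Proof. by rewrite /gvec_of_row row_mxKl row_mxKr -surjective_pairing. Qed.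

Lemma gvec_of_rowP a (w w' : 'rV[C]_(n + n)) :
  gvec_of_row (a *: w + w') = a *: gvec_of_row w + gvec_of_row w'.
Proof. by rewrite /gvec_of_row !linearP. Qed.

Lemma gvec_of_row0 : gvec_of_row 0 = 0.
Proof. by rewrite /gvec_of_row !linear0. Qed.

Lemma gvec_of_row_sum m (k : 'I_m -> C) (w : 'I_m -> 'rV[C]_(n + n)) :
  gvec_of_row (\sum_i k i *: w i) = \sum_i k i *: gvec_of_row (w i).
Proof.
elim: (index_enum _) => [|i r IH]; first by rewrite !big_nil gvec_of_row0.
by rewrite !big_cons gvec_of_rowP IH.
Qed.

(** Column b holds the coordinates of the linear form u |-> (u . psi)(T_b). *)
Definition evaluation_mx (psi : form) (T : seq (seq 'rV[C]_n))
    : 'M[C]_(n + n, size T) :=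
  \matrix_(a, b) cl (gvec_of_row (delta_mx 0 a)) psi (nth [::] T b).

Lemma mul_evaluation_mx (psi : form) T (w : 'rV[C]_(n + n)) b : is_form psi ->
  (w *m evaluation_mx psi T) 0 b = cl (gvec_of_row w) psi (nth [::] T b).
Proof.
move=> fpsi; rewrite mxE [in RHS](row_sum_delta w) gvec_of_row_sum cl_suml//.
by apply: eq_bigr => a _; rewrite mxE clZ.
Qed.

Lemma evaluation_mx_eq0 (psi : form) T (w : 'rV[C]_(n + n)) : is_form psi ->
  w *m evaluation_mx psi T = 0 <->
  forall L, L \in T -> cl (gvec_of_row w) psi L = 0.
Proof.
move=> fpsi; split=> [w0 L LT|H].
  have bT : (index L T < size T)%N by rewrite index_mem.
  have := congr1 (fun A : 'rV[C]_(size T) => A 0 (Ordinal bT)) w0.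
  by rewrite /= mul_evaluation_mx//= nth_index// mxE.
by apply/rowP => b; rewrite mul_evaluation_mx// mxE H// mem_nth.
Qed.

(** Adding an equation that fails somewhere on the common kernel lowers the
    dimension of that kernel, so finitely many equations imply all. *)
Lemma exists_separating (psi : form) : is_form psi -> exists T,
  forall w : 'rV[C]_(n + n), w *m evaluation_mx psi T = 0 ->
    cl (gvec_of_row w) psi = fun=> 0.
Proof.
move=> fpsi; pose K T := kermx (evaluation_mx psi T).
suff H m T : (\rank (K T) < m)%N -> exists T, forall w : 'rV[C]_(n + n),
    w *m evaluation_mx psi T = 0 -> cl (gvec_of_row w) psi = fun=> 0.
  exact: (H _ [::] (leqnn _)).
elim: m T => // m IH T rT.
have [sep|/existsNP[w /not_implyP[wT /eqP]]] :=
  pselect (forall w : 'rV[C]_(n + n), w *m evaluation_mx psi T = 0 ->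
     cl (gvec_of_row w) psi = fun=> 0); first by exists T.
move=> /eqP nw; have [L wL] : exists L, cl (gvec_of_row w) psi L != 0.
  by apply/not_existsP => H; apply: nw; apply/funext => L; apply/eqP/negPn/negP/H.
rewrite ltnS in rT; apply: (IH (L :: T)); apply: leq_trans rT.
apply: rank_ltmx; rewrite ltmxE; apply/andP; split.
  apply/row_subP => i; apply/sub_kermxP/evaluation_mx_eq0 => // L' L'T.
  have /sub_kermxP/evaluation_mx_eq0 := row_sub i (K (L :: T)).
  by apply=> //; rewrite inE L'T orbT.
apply/negP => /(submx_trans (introT sub_kermxP wT))/sub_kermxP.
by move=> /evaluation_mx_eq0 => /(_ fpsi L (mem_head _ _)) /eqP; apply/negP.
Qed.

Lemma csmooth_on_ext (U : set V) (phi : V -> form) xi L : open U ->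
  (forall L, csmooth_on U (fun x => phi x L)) ->
  csmooth_on U (fun x => ext xi (phi x) L).
Proof.
move=> oU; elim: L phi => [|v L IH] phi sphi.
  by under eq_fun do rewrite ext_nil; exact: csmooth_on_cst.
under eq_fun do rewrite ext_cons; apply: csmooth_onB => //.
  by apply: csmooth_onM => //; exact: csmooth_on_cst.
by apply: (IH (fun x => interior_product v (phi x))) => L'; exact: sphi.
Qed.

(** At x0 choose n combinations of equations, the columns of A x0 *m P, that are
    independent, and constant columns B completing them to an invertible matrix.
    Near x0 the matrix stays invertible, and the rows of its inverse dual to B
    span the kernel of A x *m P. This kernel has dimension n and contains the
    annihilator, which has the same dimension. *)
Lemma local_frame (O : set V) (phi : V -> form) x0 : open O -> O x0 ->
  (forall x, is_form (phi x)) ->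
  (forall L, csmooth_on O (fun x => phi x L)) ->
  (forall x, O x -> exists2 U : {vspace gvec R n},
      (forall u, cl u (phi x) = (fun=> 0) <-> u \in U) & \dim U = n) ->
  exists (N : set V) (e : 'I_n -> V -> gvec R n),
    [/\ open N, N x0, N `<=` O,
        forall i j, csmooth_on N (fun x => (e i x).1 0 j) /\
                    csmooth_on N (fun x => (e i x).2 0 j) &
        forall x, N x -> free [seq e i x | i : 'I_n] /\
          forall u, cl u (phi x) = (fun=> 0) <->
                    u \in span [seq e i x | i : 'I_n]].
Proof.
move=> oO Ox0 fphi sphi pure.
have [T sepT] := exists_separating (fphi x0).
pose A x := evaluation_mx (phi x) T.
have [U UP dU] := pure x0 Ox0.
have dUC : \dim U^C = n by rewrite dimv_compl dim_gvec dU addnK.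
pose bmx (W : {vspace gvec R n}) : 'M[C]_(n, n + n) :=
  \matrix_(i < n) row_mx ((vbasis W)`_i).1 ((vbasis W)`_i).2.
have bmxE W (w : 'rV[C]_n) :
    gvec_of_row (w *m bmx W) = \sum_i w 0 i *: (vbasis W)`_i.
  rewrite mulmx_sum_row gvec_of_row_sum; apply: eq_bigr => i _.
  by rewrite rowK gvec_of_rowK.
have bmx_in W (w : 'rV[C]_n) : \dim W = n -> gvec_of_row (w *m bmx W) \in W.
  move=> dW; rewrite bmxE memv_suml// => i _; rewrite memvZ// vbasis_mem//.
  by rewrite mem_nth// size_tuple dW.
have bmx_inj W (w : 'rV[C]_n) : \dim W = n ->
    gvec_of_row (w *m bmx W) = 0 -> w = 0.
  move=> dW; rewrite bmxE => w0; apply/rowP => i; rewrite mxE.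
  have fX : free (vbasis W) by exact: basis_free (vbasisP W).
  have sX : size (vbasis W) == n by rewrite size_tuple dW.
  by have /freeP/(_ (w 0) w0 i) : free (Tuple sX).
pose Y := bmx U^C%VS; pose Z := bmx U.
have inU w : w *m A x0 = 0 -> gvec_of_row w \in U by move=> /sepT/UP.
have ZA : Z *m A x0 = 0.
  apply/row_matrixP => i; rewrite row_mul row0 rowE.
  apply/evaluation_mx_eq0 => // L _.
  have /UP -> // : gvec_of_row (delta_mx 0 i *m Z) \in U.
  exact: bmx_in.
have fZ : row_free Z.
  apply: inj_row_free => w wZ; apply: (bmx_inj U) => //.
  by rewrite -/Z wZ gvec_of_row0.
have fYA : row_free (Y *m A x0).
  apply: inj_row_free => w; rewrite mulmxA => /inU wU; apply: (bmx_inj U^C%VS) => //.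
  apply/eqP; rewrite -memv0 -(capv_compl U) memv_cap wU /=.
  exact: bmx_in.
have [P YAP] := row_freeP fYA; have [B ZB] := row_freeP fZ.
pose M x : 'M[C]_(n + n) := row_mx (A x *m P) B.
(* The rows of Y complement the annihilator and those of Z span it; this makes
   col_mx Y Z *m M x0 block unitriangular. *)
have M0 : \det (M x0) != 0.
  have : \det (col_mx Y Z *m M x0) = 1.
    rewrite mul_col_row !mulmxA YAP ZA mul0mx ZB.
    by rewrite (det_ublock 1%:M) !det1 mulr1.
  rewrite det_mulmx; apply: contra_eq_neq => ->; rewrite mulr0.
  by rewrite eq_sym oner_neq0.
have sM i j : csmooth_on O (fun x => M x i j).
  rewrite -(splitK j); case: (fintype.split j) => k /=.
    under eq_fun do rewrite row_mxEl mxE.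
    apply: csmooth_on_sum => // b; apply: csmooth_onM => //; last first.
      exact: csmooth_on_cst.
    under eq_fun do rewrite mxE; apply: csmooth_onD => //; first exact: sphi.
    exact: csmooth_on_ext.
  by under eq_fun do rewrite row_mxEr; exact: csmooth_on_cst.
pose N := [set x | O x /\ \det (M x) != 0].
have sdet : csmooth_on O (fun x => \det (M x)) by exact: csmooth_on_det.
have oN : open N.
  rewrite openE => x [Ox Mx]; rewrite /interior.
  have h1 : nbhs x O by exact: open_nbhs_nbhs.
  have h2 := cdiff_near_neq0 (csmooth_on_cdiff sdet Ox) Mx.
  exact: filterI h1 h2.
have NO : N `<=` O by move=> x [].
pose e i x : gvec R n := gvec_of_row (row (rshift n i) (invmx (M x))).
have sN a b := csmooth_on_sub NO (sM a b).
exists N, e; split=> //.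
  move=> i j; have sinv k l : csmooth_on N (fun x => invmx (M x) k l).
    by apply: (csmooth_on_invmx k l oN sN) => x [].
  by split; rewrite /e /gvec_of_row /=; under eq_fun do rewrite !mxE; exact: sinv.
move=> x [Ox Mx].
have [W WP dW] := pure x Ox.
set X := [seq e i x | i : 'I_n].
have sizeX : size X = n by rewrite size_map size_enum_ord.
have WX : (W <= span X)%VS.
  apply/subvP => u /WP u0; rewrite -(gvec_of_rowK u).
  set w := row_mx _ _.
  have wA : w *m A x = 0.
    by apply/evaluation_mx_eq0 => // L _; rewrite gvec_of_rowK u0.
  have wM : w *m M x = row_mx 0 (w *m B).
    by rewrite mul_mx_row mulmxA wA mul0mx.
  have uM : M x \in unitmx by rewrite unitmxE unitfE.
  rewrite -(mulmxK uM w) wM mulmx_sum_row big_split_ord /=.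
  rewrite big1 ?add0r => [|i _]; last by rewrite row_mxEl mxE scale0r.
  rewrite gvec_of_row_sum memv_suml// => i _; rewrite memvZ// memv_span//.
  by apply/mapP; exists i; rewrite ?mem_enum.
have dX : (\dim (span X) <= n)%N by rewrite -[leqRHS]sizeX dim_span.
have /eqP WE : (W == span X)%VS by rewrite eqEdim WX dW.
split; first by rewrite /free -WE dW sizeX.
by move=> u; rewrite -WE; exact: WP.
Qed.
End Frames.

(** * Changes of charts *)

Section Charts.
Context {R : realType} {n : nat} (M : manifold R n).
Local Notation C := R[i].
Local Notation V := 'rV[R]_n.
Implicit Types (c : chart R M n) (p q : M) (s t : M -> gvec R n).

Lemma chart_image_open c (O : set M) : open O -> open (c @` (chart_dom c `&` O)).
Proof.
move=> oO; rewrite openE => x [p [dp Op] <-]; rewrite /interior.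
have h1 : nbhs (c p) (c @` chart_dom c).
  by apply: open_nbhs_nbhs; split; [exact: chart_img_open|exists p].
have h2 : nbhs (c p) (chart_inv c @^-1` O).
  apply: chart_inv_cont => //; rewrite chart_mapK//.
  exact: open_nbhs_nbhs.
apply: filterS2 h1 h2 => y [q dq <-] /=; rewrite chart_mapK// => Oq.
by exists q.
Qed.

Lemma transitionE c c' q : chart_dom c q -> transition c c' (c q) = c' q.
Proof. by move=> dq; rewrite /transition /= chart_mapK. Qed.

Lemma overlap_open c c' : open (c @` (chart_dom c `&` chart_dom c')).
Proof. exact/chart_image_open/chart_dom_open. Qed.

Lemma transition_smooth c c' : atlas c -> atlas c' ->
  smooth_map (c @` (chart_dom c `&` chart_dom c')) (transition c c').
Proof.
move=> ac ac' k; split; first exact: (atlas_smooth ac ac').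
by have [_] := @csmooth_on_cst R n (c @` (chart_dom c `&` chart_dom c')) 0.
Qed.

Lemma cjacobianE c c' p i k : atlas c -> atlas c' ->
  chart_dom c p -> chart_dom c' p ->
  cjacobian c c' p i k = cjac (transition c c') i k (c p).
Proof.
move=> ac ac' dp dp'; rewrite mxE jacobianE; first by rewrite /cjac cpartial_real.
by apply: (smooth_map_diff (transition_smooth ac ac')); exists p.
Qed.

#[global] Opaque cjacobian.

Lemma overlap_near c c' p (P : V -> Prop) : chart_dom c p -> chart_dom c' p ->
  (forall q, chart_dom c q -> chart_dom c' q -> P (c q)) ->
  \forall y \near c p, P y.
Proof.
move=> dp dp' H; have : nbhs (c p) (c @` (chart_dom c `&` chart_dom c')).
  by apply: open_nbhs_nbhs; split; [exact: overlap_open|exists p].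
by apply: filterS => y [q [dq dq'] <-]; exact: H.
Qed.

Lemma cjacobianM c c' c'' p : atlas c -> atlas c' -> atlas c'' ->
  chart_dom c p -> chart_dom c' p -> chart_dom c'' p ->
  cjacobian c c' p *m cjacobian c' c'' p = cjacobian c c'' p.
Proof.
move=> ac ac' ac'' d d' d''; apply/matrixP => i k; rewrite mxE.
have dF : differentiable (transition c c') (c p).
  by apply: (smooth_map_diff (transition_smooth ac ac')); exists p.
have dG : cdiff (fun y => (transition c' c'' y 0 k)%:C%C) (transition c c' (c p)).
  rewrite transitionE//.
  by apply: (csmooth_on_cdiff (transition_smooth ac' ac'' k)); exists p.
rewrite [RHS](cjacobianE i k ac ac'' d d'').
transitivity (cpartial i
    (fun y => (transition c' c'' (transition c c' y) 0 k)%:C%C) (c p)).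
  rewrite (@cpartial_comp _ _ (fun y => (transition c' c'' y 0 k)%:C%C))//.
  apply: eq_bigr => l _; congr (_ * _); first exact: (cjacobianE i l ac ac' d d').
  by rewrite (transitionE _ d); exact: (cjacobianE l k ac' ac'' d' d'').
apply: near_eq_cpartial; apply: (overlap_near d d') => q dq dq'.
by rewrite !transitionE.
Qed.

Lemma cjacobian_id c p : atlas c -> chart_dom c p -> cjacobian c c p = 1%:M.
Proof.
move=> ac dp; apply/matrixP => i k; rewrite [LHS](cjacobianE i k ac ac dp dp) /cjac.
rewrite (@near_eq_cpartial _ _ _ (fun y => (y 0 k)%:C%C)).
  rewrite cpartial_real -(@jacobianE _ _ id); last exact: ex_diff.
  by rewrite !mxE diff_val !mxE eqxx /= eq_sym; case: eqP.
by apply: (overlap_near dp dp) => q dq _; rewrite transitionE.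
Qed.

Lemma cjacobianK c c' p : atlas c -> atlas c' ->
  chart_dom c p -> chart_dom c' p -> cjacobian c c' p *m cjacobian c' c p = 1%:M.
Proof.
move=> ac ac' d d'.
exact: etrans (cjacobianM ac ac' ac d d' d) (cjacobian_id ac d).
Qed.

Definition gtrans c c' p (u : gvec R n) : gvec R n :=
  (u.1 *m cjacobian c c' p, u.2 *m (cjacobian c' c p)^T).

Lemma gtransE c c' p u : gtrans c c' p u =
  (u.1 *m cjacobian c c' p, u.2 *m (cjacobian c' c p)^T).
Proof. by []. Qed.

Lemma gtransM c c' c'' p u : atlas c -> atlas c' -> atlas c'' ->
  chart_dom c p -> chart_dom c' p -> chart_dom c'' p ->
  gtrans c' c'' p (gtrans c c' p u) = gtrans c c'' p u.
Proof.
move=> ac ac' ac'' d d' d''; rewrite /gtrans /= -!mulmxA -trmx_mul.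
congr (_, _); [congr (_ *m _)|congr (_ *m trmx _)]; exact: cjacobianM.
Qed.

Lemma gtrans_id c p u : atlas c -> chart_dom c p -> gtrans c c p u = u.
Proof.
by move=> *; rewrite /gtrans cjacobian_id// trmx1 !mulmx1 -surjective_pairing.
Qed.

Lemma gtransK c c' p : atlas c -> atlas c' -> chart_dom c p -> chart_dom c' p ->
  cancel (gtrans c c' p) (gtrans c' c p).
Proof. by move=> ? ? ? ? u; rewrite gtransM// gtrans_id. Qed.

Lemma gtransP c c' p a (u w : gvec R n) :
  gtrans c c' p (a *: u + w) = a *: gtrans c c' p u + gtrans c c' p w.
Proof. by rewrite /gtrans /= !mulmxDl -!scalemxAl. Qed.

Lemma related_gtrans c c' p u w : atlas c -> atlas c' ->
  chart_dom c p -> chart_dom c' p ->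
  related (transition c c') (c p) u w <-> w = gtrans c c' p u.
Proof.
move=> ac ac' d d'.
have JE := cjacobianE _ _ ac ac' d d'.
have E1 (v : 'rV[C]_n) k :
    \sum_i v 0 i * cjac (transition c c') i k (c p) = (v *m cjacobian c c' p) 0 k.
  by rewrite mxE; apply: eq_bigr => i _; rewrite JE.
have E2 (v : 'rV[C]_n) i :
    \sum_k v 0 k * cjac (transition c c') i k (c p) = (v *m (cjacobian c c' p)^T) 0 i.
  by rewrite mxE; apply: eq_bigr => k _; rewrite [_^T _ _]mxE JE.
split.
  move=> [H1 H2]; rewrite [w]surjective_pairing /gtrans; congr (_, _).
    by apply/rowP => k; rewrite H1 E1.
  have -> : u.2 = w.2 *m (cjacobian c c' p)^T by apply/rowP => i; rewrite H2 E2.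
  by rewrite -mulmxA -trmx_mul cjacobianK// trmx1 mulmx1.
move=> ->; split=> [k|i]; first by rewrite E1.
by rewrite E2 /= -mulmxA -trmx_mul cjacobianK// trmx1 mulmx1.
Qed.

#[global] Opaque gtrans.

Lemma gdot_gtrans c c' p u w : atlas c -> atlas c' ->
  chart_dom c p -> chart_dom c' p ->
  gdot (gtrans c c' p u) (gtrans c c' p w) = gdot u w.
Proof.
move=> ac ac' d d'; have E := related_gtrans _ _ ac ac' d d'.
by congr (_ + _); apply/esym/(@related_contract _ _ (transition c c') (c p));
  apply/E.
Qed.

Lemma chart_at_atlas p : atlas (chart_at p).
Proof. by rewrite /chart_at; case: (cid2 _). Qed.

Lemma chart_at_dom p : chart_dom (chart_at p) p.
Proof. by rewrite /chart_at; case: (cid2 _). Qed.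

Hint Resolve chart_at_atlas chart_at_dom : core.

Lemma gsection_inE c s p : chart_dom c p ->
  gsection_in c s (c p) = gtrans (chart_at p) c p (s p).
Proof. by move=> dp; rewrite /gsection_in chart_mapK. Qed.

Lemma form_field_inE c (phi : M -> mixed_form R n) p L : chart_dom c p ->
  form_field_in c phi (c p) L = phi p [seq v *m cjacobian c (chart_at p) p | v <- L].
Proof. by move=> dp; rewrite /form_field_in /form_in chart_mapK. Qed.

Lemma gsection_in_related c c' s p : atlas c -> atlas c' ->
  chart_dom c p -> chart_dom c' p ->
  related (transition c c') (c p) (gsection_in c s (c p)) (gsection_in c' s (c' p)).
Proof.
move=> ac ac' d d'; apply/(related_gtrans _ _ ac ac' d d').
by rewrite (gsection_inE _ d) (gsection_inE _ d'); apply/esym/gtransM.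
Qed.

Lemma is_form_map (phi : mixed_form R n) (A : 'M[C]_n) :
  is_form phi -> is_form (fun L => phi [seq v *m A | v <- L]).
Proof.
move=> [lin alt]; split=> [s1 s2 a u w|s1 s2 s3 u].
  by rewrite !map_cat /= mulmxDl -scalemxAl lin.
by rewrite !map_cat /= map_cat /= alt.
Qed.

Lemma cl_map (u : gvec R n) (phi : mixed_form R n) (A B : 'M[C]_n) L :
  A *m B = 1%:M ->
  cl (u.1 *m A, u.2 *m B^T) (fun L => phi [seq v *m B | v <- L]) L =
  cl u phi [seq v *m B | v <- L].
Proof.
move=> AB; rewrite /cl /interior_product /= -mulmxA AB mulmx1; congr (_ + _).
elim: L phi => [|v L IH] phi; first by rewrite !ext_nil.
rewrite /= !ext_cons; congr (_ * _ - _); last exact: IH.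
rewrite /contract.
have E (a b : 'rV[C]_n) : \sum_j b 0 j * a 0 j = (b *m a^T) 0 0.
  by rewrite mxE; apply: eq_bigr => j _; rewrite mxE.
by rewrite !E trmx_mul mulmxA.
Qed.

(** The Clifford action commutes with changes of coordinates: a vector moved to
    another chart is moved back when it becomes an argument of the transported form,
    and covectors transform contragrediently. *)
Lemma cl_chart c (phi : M -> mixed_form R n) p u : atlas c -> chart_dom c p ->
  cl u (form_field_in c phi (c p)) = (fun=> 0) <->
  cl (gtrans c (chart_at p) p u) (phi p) = fun=> 0.
Proof.
move=> ac dp; set w := gtrans _ _ _ u.
have uE : u = gtrans (chart_at p) c p w by rewrite gtransK.
have FE : form_field_in c phi (c p) =
    fun L => phi p [seq v *m cjacobian c (chart_at p) p | v <- L].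
  by apply/funext => L; rewrite form_field_inE.
have JJ : cjacobian (chart_at p) c p *m cjacobian c (chart_at p) p = 1%:M.
  exact: cjacobianK.
rewrite FE uE gtransE; split=> H; apply/funext => L.
  have -> : L = [seq v *m cjacobian c (chart_at p) p |
                 v <- [seq v *m cjacobian (chart_at p) c p | v <- L]].
    rewrite -map_comp -[LHS]map_id; apply: eq_map => v /=.
    by rewrite -mulmxA JJ mulmx1.
  rewrite -(cl_map w (phi p) _ JJ).
  exact: (congr1 (@^~ [seq v *m cjacobian (chart_at p) c p | v <- L]) H).
by rewrite (cl_map w (phi p) _ JJ) H.
Qed.

Lemma span_linear_image (G : gvec R n -> gvec R n) (X : seq (gvec R n)) u :
  (forall a v w, G (a *: v + w) = a *: G v + G w) ->
  u \in span X -> G u \in span (map G X).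
Proof.
move=> linG.
have G0 : G 0 = 0.
  by have := linG (-1) 0 0; rewrite scaler0 addr0 scaleN1r addNr.
move=> /(coord_span (X := in_tuple X)) ->.
elim: (index_enum _) => [|i r IH]; first by rewrite big_nil G0 mem0v.
rewrite big_cons linG memvD// memvZ// memv_span//.
by apply: map_f; rewrite mem_nth.
Qed.

End Charts.

(** * Generalized Calabi-Yau structures *)

Section CalabiYau.
Context {R : realType} {n : nat} (M : manifold R n).
Local Notation C := R[i].
Local Notation V := 'rV[R]_n.
Implicit Types (c : chart R M n) (p q : M) (s t : M -> gvec R n).

Lemma vspace_transport (G G' : gvec R n -> gvec R n) (W : {vspace gvec R n}) :
  (forall a v w, G (a *: v + w) = a *: G v + G w) ->
  (forall a v w, G' (a *: v + w) = a *: G' v + G' w) ->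
  cancel G G' -> cancel G' G ->
  exists2 U : {vspace gvec R n},
    (forall u, u \in U <-> G' u \in W) & \dim U = \dim W.
Proof.
move=> lG lG' GK G'K.
have spV (U : {vspace gvec R n}) : span (vbasis U) = U.
  exact: span_basis (vbasisP U).
have mapK X : map G' (map G X) = X :> seq (gvec R n).
  by rewrite -map_comp (eq_map (g := id)) ?map_id// => v /=; exact: GK.
have H u : u \in span (map G (vbasis W)) <-> G' u \in W.
  split=> [/(span_linear_image lG')|]; first by rewrite mapK spV.
  by rewrite -{1}(spV W) => /(span_linear_image lG); rewrite G'K.
exists (span (map G (vbasis W))); first exact: H.
apply/eqP; rewrite eqn_leq; apply/andP; split.
  by apply: leq_trans (dim_span _) _; rewrite size_map size_tuple.
set U := span _.
have -> : W = span (map G' (vbasis U)).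
  apply/vspaceP => u; apply/idP/idP => [uW|].
    have /(span_linear_image lG') : G u \in span (vbasis U).
      by rewrite spV; apply/H; rewrite GK.
    by rewrite GK.
  move=> /(span_linear_image lG).
  rewrite -map_comp (eq_map (g := id)) => [|v /=]; last exact: G'K.
  by rewrite map_id spV => /H; rewrite GK.
by apply: leq_trans (dim_span _) _; rewrite size_map size_tuple.
Qed.

Hint Resolve chart_at_atlas chart_at_dom : core.

(** In any chart c the components are gtrans c0 c applied to e (T x), where
    T is the transition map from c to c0: compositions of smooth maps. *)
Lemma gtrans_frame_smooth c0 c (U : set M) (N : set V) (e : V -> gvec R n) :
  atlas c0 -> atlas c -> open U -> U `<=` chart_dom c0 -> open N ->
  (forall q, U q -> N (c0 q)) ->
  (forall k, csmooth_on N (fun x => (e x).1 0 k) /\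
             csmooth_on N (fun x => (e x).2 0 k)) ->
  forall j, let s q := gtrans c0 (chart_at q) q (e (c0 q)) in
    csmooth_on (c @` (chart_dom c `&` U)) (fun x => (gsection_in c s x).1 0 j) /\
    csmooth_on (c @` (chart_dom c `&` U)) (fun x => (gsection_in c s x).2 0 j).
Proof.
move=> ac0 ac oU Uc0 oN UN se j s.
set D := c @` _; have oD : open D by exact: chart_image_open.
pose T := transition c c0.
have DO : D `<=` c @` (chart_dom c `&` chart_dom c0).
  by move=> _ [q [dq Uq] <-]; exists q => //; split=> //; exact: Uc0.
have sT : smooth_map D T.
  by move=> k; exact: csmooth_on_sub DO (transition_smooth ac ac0 k).
have TN x : D x -> N (T x).
  by move=> [q [dq Uq] <-]; rewrite /T transitionE//; exact: UN.
have TO x : D x -> (c0 @` (chart_dom c0 `&` chart_dom c)) (T x).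
  move=> [q [dq Uq] <-]; rewrite /T transitionE//; exists q => //.
  by split=> //; exact: Uc0.
have sE q : chart_dom c q -> U q ->
    gsection_in c s (c q) = gtrans c0 c q (e (T (c q))).
  move=> dq Uq; have d0 := Uc0 _ Uq.
  rewrite (gsection_inE _ dq) /T (transitionE _ dq) /s.
  exact: gtransM.
split.
  apply: (@csmooth_on_eq _ _ _ oD
    (fun x => \sum_k (e (T x)).1 0 k * cjac (transition c0 c) k j (T x))).
    move=> _ [q [dq Uq] <-]; have d0 := Uc0 _ Uq; rewrite sE// mxE.
    by apply: eq_bigr => k _; rewrite cjacobianE// /T transitionE.
  apply: csmooth_on_sum => // k; apply: csmooth_onM => //.
    by apply: (@csmooth_on_comp _ _ D N T (fun y => (e y).1 0 k)) => //; case: (se k).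
  apply: (csmooth_on_comp oD sT TO); apply: csmooth_on_cpartial.
  exact: transition_smooth.
apply: (@csmooth_on_eq _ _ _ oD
  (fun x => \sum_k (e (T x)).2 0 k * cjac (transition c c0) j k x)).
  move=> _ [q [dq Uq] <-]; have d0 := Uc0 _ Uq; rewrite sE// mxE.
  by apply: eq_bigr => k _; rewrite [_^T _ _]mxE cjacobianE.
apply: csmooth_on_sum => // k; apply: csmooth_onM => //.
  by apply: (@csmooth_on_comp _ _ D N T (fun y => (e y).2 0 k)) => //; case: (se k).
by apply: csmooth_on_cpartial; exact: csmooth_on_sub DO (transition_smooth ac ac0 k).
Qed.

Lemma smooth_gsection_gcdiff s c x : smooth_gsection setT s -> atlas c ->
  (c @` chart_dom c) x -> gcdiff (gsection_in c s) x.
Proof.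
move=> ss ac; rewrite -(setIT (chart_dom c)) => dx k.
have [s1 s2] := ss c ac k.
by split; [exact: csmooth_on_cdiff s1 dx|exact: csmooth_on_cdiff s2 dx].
Qed.

(** The bracket at p is computed in a chart depending on p; by naturality it can
    be computed in any chart around p. *)
Lemma gsection_in_courant s t c p :
  smooth_gsection setT s -> smooth_gsection setT t -> atlas c -> chart_dom c p ->
  gsection_in c (courant s t) (c p) =
  courant_coord (gsection_in c s) (gsection_in c t) (c p).
Proof.
move=> ss st ac dp; set c' := chart_at p.
have ac' : atlas c' by exact: chart_at_atlas.
have dp' : chart_dom c' p by exact: chart_at_dom.
rewrite gsection_inE// -/c'; apply/esym/related_gtrans => //.
rewrite -(transitionE c dp').
apply: (@related_courant _ _ (c' @` (chart_dom c' `&` chart_dom c))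
   (c @` chart_dom c) (transition c' c)).
- exact: overlap_open.
- exact: transition_smooth.
- by move=> _ [q [dq' dq] <-]; rewrite transitionE//; exists q.
- by move=> _ [q [dq' dq] <-]; apply: smooth_gsection_gcdiff => //; exists q.
- by move=> _ [q [dq' dq] <-]; apply: smooth_gsection_gcdiff => //; exists q.
- by move=> x dx; exact: smooth_gsection_gcdiff.
- by move=> x dx; exact: smooth_gsection_gcdiff.
- by move=> _ [q [dq' dq] <-]; rewrite transitionE//; exact: gsection_in_related.
- by move=> _ [q [dq' dq] <-]; rewrite transitionE//; exact: gsection_in_related.
- by exists p.
Qed.

Lemma csmooth_on_courant_coord (U : set V) (s t : V -> gvec R n) : open U ->
  (forall k, csmooth_on U (fun x => (s x).1 0 k) /\
             csmooth_on U (fun x => (s x).2 0 k)) ->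
  (forall k, csmooth_on U (fun x => (t x).1 0 k) /\
             csmooth_on U (fun x => (t x).2 0 k)) ->
  forall j, csmooth_on U (fun x => (courant_coord s t x).1 0 j) /\
            csmooth_on U (fun x => (courant_coord s t x).2 0 j).
Proof.
move=> oU ss st j.
have s1 k : csmooth_on U (fun x => (s x).1 0 k) by case: (ss k).
have s2 k : csmooth_on U (fun x => (s x).2 0 k) by case: (ss k).
have t1 k : csmooth_on U (fun x => (t x).1 0 k) by case: (st k).
have t2 k : csmooth_on U (fun x => (t x).2 0 k) by case: (st k).
have sc (X : V -> 'rV[C]_n) f : (forall k, csmooth_on U (fun x => X x 0 k)) ->
    csmooth_on U f -> csmooth_on U (fun x => cderive (X x) f x).
  move=> sX sf; apply: csmooth_on_sum => // k; apply: csmooth_onM => //.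
  exact: csmooth_on_cpartial.
have sl (X eta : V -> 'rV[C]_n) : (forall k, csmooth_on U (fun x => X x 0 k)) ->
    (forall k, csmooth_on U (fun x => eta x 0 k)) ->
    csmooth_on U (fun x => lie_derive X eta x 0 j).
  move=> sX se; under eq_fun do rewrite mxE.
  apply: csmooth_onD => //; first exact: sc.
  apply: csmooth_on_sum => // k; apply: csmooth_onM => //.
  exact: csmooth_on_cpartial.
have sk (X eta : V -> 'rV[C]_n) : (forall k, csmooth_on U (fun x => X x 0 k)) ->
    (forall k, csmooth_on U (fun x => eta x 0 k)) ->
    csmooth_on U (fun x => contract (X x) (eta x)).
  by move=> sX se; apply: csmooth_on_sum => // k; exact: csmooth_onM.
split=> /=.
  under eq_fun do rewrite mxE.
  by apply: csmooth_onB => //; exact: sc.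
pose f x := contract (s x).1 (t x).2 - contract (t x).1 (s x).2.
apply: (@csmooth_on_eq _ _ _ oU (fun x =>
  lie_derive (fun y => (s y).1) (fun y => (t y).2) x 0 j -
  lie_derive (fun y => (t y).1) (fun y => (s y).2) x 0 j -
  2^-1 * cpartial j f x)); first by move=> x _; rewrite !mxE.
apply: csmooth_onB => //; first by apply: csmooth_onB => //; exact: sl.
apply: csmooth_onM => //; first exact: csmooth_on_cst.
by apply: csmooth_on_cpartial; apply: csmooth_onB => //; exact: sk.
Qed.

Variable phi : M -> mixed_form R n.
Hypothesis cy : generalized_calabi_yau phi.

Let fphi p : is_form (phi p).
Proof. by case: cy => [[H _] _ _ _]. Qed.

Lemma annihilatorE p u : annihilator phi p u <-> cl u (phi p) = fun=> 0.
Proof. by rewrite /annihilator /= cliffordE. Qed.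

Lemma no_common_annihilator p u : cl u (phi p) = (fun=> 0) ->
  cl u (conj_form (phi p)) = (fun=> 0) -> u = 0.
Proof.
move=> u1 u2; apply/eqP/negPn/negP => /eqP u0.
have [ev od] :=
  common_annihilator_pairing (fphi p) (is_form_conj (fphi p)) u0 u1 u2.
by case: cy => _ _ _ [[_ /(_ p)]|[_ /(_ p)]].
Qed.

(** Otherwise the Clifford relation forces phi p = 0, and u <> 0 kills phi p and
    its conjugate. *)
Lemma annihilator_isotropic p u w :
  cl u (phi p) = (fun=> 0) -> cl w (phi p) = (fun=> 0) -> gdot u w = 0.
Proof.
move=> u0 w0; apply/eqP/negPn/negP => uw0.
have phi0 : phi p = fun=> 0.
  apply/funext => L; have := cl_anticommute u w L (fphi p).
  rewrite u0 w0 !cl0 addr0 => /esym/eqP.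
  by rewrite mulf_eq0 (negbTE uw0) => /eqP.
have c0 : conj_form (fun=> 0) = (fun=> 0) :> mixed_form R n.
  by apply/funext => L; rewrite /conj_form conjc0.
have uz : u = 0 by apply: (@no_common_annihilator p); rewrite phi0 ?c0 cl0.
move: uw0; rewrite uz /gdot /= contract0l contract0r addr0.
by rewrite eqxx.
Qed.

Lemma annihilator_conj p u v : cl u (phi p) = (fun=> 0) ->
  cl v (phi p) = (fun=> 0) -> u = conjg v -> u = 0.
Proof.
move=> u0 v0 uv; apply: (no_common_annihilator u0); rewrite uv cl_conj v0.
by apply/funext => L; rewrite /conj_form conjc0.
Qed.

Lemma annihilator_subbundle : subbundle (annihilator phi).
Proof.
move=> p; pose c0 := chart_at p.
have ac0 : atlas c0 by exact: chart_at_atlas.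
have dp : chart_dom c0 p by exact: chart_at_dom.
have [[_ sphi] _ pure _] := cy.
pose O := c0 @` chart_dom c0.
have oO : open O by exact: chart_img_open.
have Op : O (c0 p) by exists p.
have fF x : is_form (form_field_in c0 phi x) by exact: is_form_map.
have pureF x : O x -> exists2 U : {vspace gvec R n},
    (forall u, cl u (form_field_in c0 phi x) = (fun=> 0) <-> u \in U) & \dim U = n.
  move=> [q dq <-]; have [W WE dW] := pure q.
  have [U UW dU] := vspace_transport W
    (@gtransP _ _ M (chart_at q) c0 q) (@gtransP _ _ M c0 (chart_at q) q)
    (gtransK (chart_at_atlas q) ac0 (chart_at_dom q) dq)
    (gtransK ac0 (chart_at_atlas q) dq (chart_at_dom q)).
  exists U; last by rewrite dU.
  by move=> u; rewrite cl_chart// -annihilatorE WE UW.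
have [N [e [oN Np NO se eP]]] := local_frame oO Op fF (sphi c0 ac0) pureF.
pose U := chart_dom c0 `&` (c0 @^-1` N).
have oU : open U.
  rewrite openE => q [dq Nq]; rewrite /interior; apply: filterI.
    by apply: open_nbhs_nbhs; split=> //; exact: chart_dom_open.
  by apply: chart_map_cont => //; exact: open_nbhs_nbhs.
exists n, U, (fun i q => gtrans c0 (chart_at q) q (e i (c0 q))); split=> //.
  move=> i c ac j; apply: (@gtrans_frame_smooth c0 c U N (e i)) => //.
  - by move=> q [].
  - by move=> q [].
move=> q [dq Nq]; have [fe spe] := eP _ Nq; have [W WE dW] := pure q.
set X := [seq _ | _ : _].
have XE : X = map (gtrans c0 (chart_at q) q) [seq e i (c0 q) | i : 'I_n].
  by rewrite -map_comp.
have K1 : cancel (gtrans c0 (chart_at q) q) (gtrans (chart_at q) c0 q).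
  exact: gtransK.
have K2 : cancel (gtrans (chart_at q) c0 q) (gtrans c0 (chart_at q) q).
  exact: gtransK.
have spX : span X = W.
  apply/vspaceP => u.
  have uW : u \in W <->
      gtrans (chart_at q) c0 q u \in span [seq e i (c0 q) | i : 'I_n].
    by rewrite -spe cl_chart// K2 -annihilatorE WE.
  apply/idP/idP.
    rewrite XE => /(span_linear_image (@gtransP _ _ M (chart_at q) c0 q)).
    rewrite -map_comp (eq_map (g := id)) => [|v /=]; last exact: K1.
    by rewrite map_id => /uW.
  move=> /uW /(span_linear_image (@gtransP _ _ M c0 (chart_at q) q)).
  by rewrite K2 XE.
by rewrite WE spX /free spX dW size_map size_enum_ord.
Qed.

Lemma annihilator_courant s t : section_of (annihilator phi) s ->
  section_of (annihilator phi) t -> section_of (annihilator phi) (courant s t).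
Proof.
move=> [ss sE] [st tE]; split.
  move=> c ac j; have oU : open (c @` (chart_dom c `&` setT)).
    exact/chart_image_open/openT.
  have [h1 h2] := csmooth_on_courant_coord oU (ss c ac) (st c ac) j.
  by split; [apply: csmooth_on_eq h1|apply: csmooth_on_eq h2] => //;
    move=> _ [p [dp _] <-]; rewrite gsection_in_courant.
move=> p; apply/annihilatorE; pose c := chart_at p.
have ac : atlas c by exact: chart_at_atlas.
have dp : chart_dom c p by exact: chart_at_dom.
have [[_ sphi] dphi _ _] := cy.
have phiE : form_field_in c phi (c p) = phi p.
  apply/funext => L; rewrite form_field_inE// cjacobian_id//.
  by rewrite (eq_map (g := id)) ?map_id// => v; rewrite mulmx1.
have annE (w : M -> gvec R n) : (forall q, annihilator phi q (w q)) ->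
    forall q, chart_dom c q ->
    cl (gsection_in c w (c q)) (form_field_in c phi (c q)) = fun=> 0.
  move=> wE q dq; apply/cl_chart => //; rewrite gsection_inE// gtransK//.
  exact/annihilatorE.
have Oc : (c @` chart_dom c) (c p) by exists p.
rewrite -phiE; apply: courant_annihilates.
- exact: smooth_gsection_gcdiff.
- exact: smooth_gsection_gcdiff.
- by move=> y; exact: is_form_map.
- by move=> L; exact: csmooth_on_cdiff (sphi c ac L) Oc.
- by apply: (overlap_near dp dp) => q dq _; exact: annE.
- by apply: (overlap_near dp dp) => q dq _; exact: annE.
- apply: (overlap_near dp dp) => q dq _.
  rewrite (gsection_inE _ dq) (gsection_inE _ dq) gdot_gtrans//.
  by apply: (@annihilator_isotropic q); exact/annihilatorE.
- exact: dphi.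
Qed.

Theorem calabi_yau_generalized_complex :
  generalized_complex_structure (annihilator phi).
Proof.
split.
- exact: annihilator_subbundle.
- move=> p; split=> [w|u v /annihilatorE u0 /annihilatorE v0]; last first.
    exact: (annihilator_conj u0 v0).
  have [_ _ pure _] := cy; have [U UE dU] := pure p.
  have inU u : u \in U <-> cl u (phi p) = fun=> 0.
    by rewrite -annihilatorE UE.
  have [||u [v [/inU uE /inU vE ->]]] := @conjg_decomposition _ _ U _ _ w.
  + exact: dU.
  + move=> u /inU u0 /inU cu0; apply: (annihilator_conj u0 cu0).
    by rewrite conjgK.
  by exists u, v; split=> //; exact/annihilatorE.
- exact: annihilator_courant.
- move=> p u w /annihilatorE u0 /annihilatorE w0.
  have := annihilator_isotropic u0 w0; rewrite /gdot /gmetric => ->.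
  by rewrite mulr0.
Qed.
End CalabiYau.

Local Close Scope ring_scope.
Local Close Scope classical_set_scope.

Theorem proposition1 (R : realType) (m : nat) (M : manifold R (2 * m))
    (phi : M -> mixed_form R (2 * m)) :
  generalized_calabi_yau phi ->
  generalized_complex_structure (annihilator phi).
Proof. exact: calabi_yau_generalized_complex. Qed.
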